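(* Let $(a_n)_{n\ge 1}$ be a positive, real-valued lacunary sequence. Let $L=L(N)>0$ be a real-valued function of $N\in\mathbb{N}$ such that $L(N)\to\infty$ as $N\to\infty$ and such that for all $\eta>0$ we have $L(N)=O(N^{\eta})$. Assume that there exists $\epsilon>0$ such that $L(N+1)-L(N)=O(N^{-\epsilon})$. Then for (Lebesgue) almost all $\alpha\in\mathbb{R}$, the following holds: for any real numbers $u<v$, $$\mathrm{meas}\left\{x\in[0,1):\ u\le\frac{S_N(L,\alpha)(x)-L}{\sqrt{L}}\le v\right\}\longrightarrow\frac{1}{\sqrt{2\pi}}\int_u^v e^{-t^2/2}\,dt$$ as $N\to\infty$.
   Context: A positive, real-valued lacunary sequence is a real sequence $(a_n)_{n\ge1}$ with $a_1>0$ for which there is a constant $C>1$ such that $a_{n+1}\ge C a_n$ for all $n\ge1$. Let $\chi=\chi_{[-1/2,1/2]}$ be the characteristic function of $[-1/2,1/2]$. For $\alpha\in\mathbb{R}$, $x\in[0,1)$, put $$S_N(L,\alpha)(x)=\sum_{j=1}^N\sum_{n\in\mathbb{Z}}\chi\left(\frac{\alpha a_j-x+n}{L/N}\right),$$ with $L=L(N)$. ''meas'' is Lebesgue measure. *)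

(* Defs.v *)
From HB Require Import structures.
From mathcomp Require Import all_boot all_order all_algebra.
From mathcomp Require Import all_classical all_reals all_analysis.
Set Implicit Arguments.
Unset Strict Implicit.
Unset Printing Implicit Defensive.
Import Order.TTheory GRing.Theory Num.Theory.
Import numFieldNormedType.Exports.
Local Open Scope classical_set_scope.
Local Open Scope ring_scope.

(* Sequences are indexed from 1: the value [a 0] is never used. *)
Definition positive_lacunary (R : realType) (a : nat -> R) : Prop :=
  0 < a 1%N /\
  exists2 C : R, 1 < C & forall n : nat, (1 <= n)%N -> C * a n <= a n.+1.

Definition chi (R : realType) : R -> R := \1_(`[- (1 / 2), 1 / 2]).

(* The inner sum over [int] is a finitely supported sum ([fsbigop]): if
   [0 < l] and [0 < N], only finitely many [n] contribute. *)
Definition S_ (R : realType) (a : nat -> R) (N : nat) (l alpha x : R) : R :=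
  \sum_(1 <= j < N.+1) \sum_(n \in [set: int])
    chi ((alpha * a j - x + n%:~R) / (l / N%:R)).

(* Main.v *)
Require Import Defs.
From HB Require Import structures.
From mathcomp Require Import all_boot all_order all_algebra.
From mathcomp Require Import all_classical all_reals all_analysis.
From mathcomp Require Import measurable_realfun.
From mathcomp Require Import ring lra zify.
Import Order.TTheory GRing.Theory Num.Theory.
Import numFieldNormedType.Exports.
Set Implicit Arguments.
Unset Strict Implicit.
Unset Printing Implicit Defensive.
Local Open Scope classical_set_scope.
Local Open Scope ring_scope.

(** Write [w = L / N], let the hit [h_j] be the indicator that [alpha a_j - x] is
    within [w / 2] of an integer, and [S_k = h_1 + ... + h_k]. For large [N] the
    centred variable is [(S_N - L) / sqrt L], where [x] is uniform on the unit interval and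
    [alpha] is fixed. The proof replaces the hits one at a time by Gaussian
    increments, in the manner of Lindeberg, and averages over [alpha] as well to
    show that this works for almost every [alpha].

    The test function is [heat v q y], the normal distribution function of
    variance [q], which smooths the indicator of [y <= v] and solves the heat
    equation. With [U_j s = heat v (p + 1 - j / N) ((s - j w) / sqrt L)], the
    difference [U_N (S_N) - U_0 0] is exactly the sum over [j] of
    [(h_j - w) * (U_j (S_(j-1) + 1) - U_j (S_(j-1)))] and of a deterministic error
    which the heat equation makes negligible as [L] grows ([heat_step],
    [telescope_le]). So everything rests on the first sum, integrated over [x].

    In that sum [S_(j-1)] is replaced by [S_(j-D)], at the cost of pairs of hits
    with neighbouring indices; these are rare on average over [x] and [alpha]
    ([cross_sum_mean]). The remaining sum has a small second moment over [alpha]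
    ([main_sum_second_moment]): terms with [|i - j| < D] are bounded trivially,
    while for [i + D <= j] the centred hit [h_j - w] oscillates in [alpha] with
    frequency [a_j], whereas the other factors are step functions of [alpha] with
    [O(N a_(j-D))] jumps, so that the correlation is [O(N C^-D)] ([far_le]). Only
    the past of [j] enters the coefficients, so no joint law of later points is
    ever involved. The outcome is a bound [N^-delta] in mean square.

    A power of [N] is enough for an almost sure statement because the points and
    the windows can be sampled sparsely: it is applied to [N = m ^ 7] and to all
    windows [i / m] up to [m], for which the errors are summable ([grid_ae]). As
    [L] grows more slowly than any power of [N], rounding an arbitrary [N] and
    [L N] to this grid changes the number of hits by [o(1)] in [L^1(dx)]
    ([compare]). Finally indicators of intervals are squeezed between smoothed
    indicators, for countably many [v] and [p] ([cvg_distribution]). *)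

(** * Bounded measurable functions on finite measure spaces *)

Section bounded_measurable.
Context {d : measure_display} {T : measurableType d} {R : realType}.

(** On a finite measure space these functions form an algebra of integrable
    functions, stable under partial integration: no integrability condition has
    to be carried along. *)
Definition bmeas (f : T -> R) :=
  measurable_fun setT f /\ exists M, forall x, `|f x| <= M.

Lemma bmeas_cst c : bmeas (fun=> c).
Proof. by split; [exact: measurable_cst|exists `|c|]. Qed.

Lemma bmeasD f g : bmeas f -> bmeas g -> bmeas (fun x => f x + g x).
Proof.
move=> [mf [M fM]] [mg [K gK]]; split; first exact: measurable_funD.
by exists (M + K) => x; rewrite (le_trans (ler_normD _ _))// lerD.
Qed.

Lemma bmeasM f g : bmeas f -> bmeas g -> bmeas (fun x => f x * g x).
Proof.
move=> [mf [M fM]] [mg [K gK]]; split; first exact: measurable_funM.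
by exists (M * K) => x; rewrite normrM ler_pM.
Qed.

Lemma bmeasN f : bmeas f -> bmeas (fun x => - f x).
Proof.
move=> [mf [M fM]]; split; first exact: measurableT_comp.
by exists M => x; rewrite normrN.
Qed.

Lemma bmeasB f g : bmeas f -> bmeas g -> bmeas (fun x => f x - g x).
Proof. by move=> bf bg; apply: bmeasD => //; exact: bmeasN. Qed.

Lemma bmeas_norm f : bmeas f -> bmeas (fun x => `|f x|).
Proof.
move=> [mf [M fM]]; split; first exact: measurableT_comp.
by exists M => x; rewrite normr_id.
Qed.

Lemma bmeas_sum (I : eqType) (r : seq I) (P : pred I) (f : I -> T -> R) :
  (forall i, i \in r -> P i -> bmeas (f i)) -> bmeas (fun x => \sum_(i <- r | P i) f i x).
Proof.
elim: r => [_|i r IH H].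
  by under eq_fun do rewrite big_nil; exact: bmeas_cst.
under eq_fun do rewrite big_cons.
case Pi: (P i); last by apply: IH => j jr; apply: H; rewrite inE jr orbT.
have IHr : bmeas (fun x => \sum_(j <- r | P j) f j x).
  by apply: IH => j jr; apply: H; rewrite inE jr orbT.
by apply: bmeasD => //; apply: H => //; rewrite inE eqxx.
Qed.

Variable mu : {finite_measure set T -> \bar R}.

Lemma bmeas_integrable f : bmeas f -> mu.-integrable setT (EFin \o f).
Proof.
move=> [mf [M fM]]; apply: measurable_bounded_integrable => //.
- by rewrite ltey_eq fin_num_measure.
- exists M; split; first by rewrite num_real.
  by move=> x Mx y _ /=; rewrite (le_trans (fM y))// ltW.
Qed.

Lemma bintD f g : bmeas f -> bmeas g ->
  \int[mu]_x (f x + g x) = \int[mu]_x f x + \int[mu]_x g x.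
Proof. by move=> bf bg; rewrite RintegralD//; exact: bmeas_integrable. Qed.

Lemma bintB f g : bmeas f -> bmeas g ->
  \int[mu]_x (f x - g x) = \int[mu]_x f x - \int[mu]_x g x.
Proof. by move=> bf bg; rewrite RintegralB//; exact: bmeas_integrable. Qed.

Lemma bintZ c f : bmeas f -> \int[mu]_x (c * f x) = c * \int[mu]_x f x.
Proof. by move=> bf; rewrite RintegralZl//; exact: bmeas_integrable. Qed.

Lemma bintZr c f : bmeas f -> \int[mu]_x (f x * c) = \int[mu]_x f x * c.
Proof. by move=> bf; rewrite RintegralZr//; exact: bmeas_integrable. Qed.

Lemma bint_cst c : \int[mu]_(x in setT) c = c * fine (mu setT).
Proof. exact: Rintegral_cst. Qed.

Lemma bint_sum (I : eqType) (r : seq I) (P : pred I) (f : I -> T -> R) :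
  (forall i, i \in r -> P i -> bmeas (f i)) ->
  \int[mu]_x (\sum_(i <- r | P i) f i x) = \sum_(i <- r | P i) \int[mu]_x f i x.
Proof.
elim: r => [_|i r IH H].
  rewrite big_nil; under eq_Rintegral do rewrite big_nil.
  by rewrite bint_cst mul0r.
have Hr : forall j, j \in r -> P j -> bmeas (f j).
  by move=> j jr; apply: H; rewrite inE jr orbT.
rewrite big_cons; under eq_Rintegral do rewrite big_cons.
case Pi: (P i); last exact: IH.
rewrite bintD ?IH//; last exact: bmeas_sum.
by apply: H => //; rewrite inE eqxx.
Qed.

Lemma bint_le f g : bmeas f -> bmeas g -> (forall x, f x <= g x) ->
  \int[mu]_x f x <= \int[mu]_x g x.
Proof.
by move=> bf bg fg; apply: le_Rintegral => //; exact: bmeas_integrable.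
Qed.

Lemma bint_abs f : bmeas f -> `|\int[mu]_x f x| <= \int[mu]_x `|f x|.
Proof. by move=> bf; apply: le_normr_Rintegral => //; exact: bmeas_integrable. Qed.

Lemma bint_absle f M : bmeas f -> (forall x, `|f x| <= M) ->
  `|\int[mu]_x f x| <= M * fine (mu setT).
Proof.
move=> bf fM; rewrite (le_trans (bint_abs bf))// -bint_cst.
by apply: bint_le => //; [exact: bmeas_norm|exact: bmeas_cst].
Qed.

Lemma EFin_bint f : bmeas f -> (\int[mu]_x (f x)%:E)%E = (\int[mu]_x f x)%:E.
Proof.
move=> bf; rewrite /Rintegral fineK//.
by apply: integrable_fin_num => //; exact: bmeas_integrable.
Qed.

End bounded_measurable.

Section bounded_fubini.
Context {d1 d2 : measure_display} {T1 : measurableType d1} {T2 : measurableType d2}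
  {R : realType}.
Variables (m1 : {finite_measure set T1 -> \bar R})
          (m2 : {finite_measure set T2 -> \bar R}).

Lemma bmeas_sec1 (f : T1 * T2 -> R) x : bmeas f -> bmeas (fun y => f (x, y)).
Proof.
move=> [mf [M fM]]; split; last by exists M.
exact: measurableT_comp.
Qed.

Lemma bmeas_sec2 (f : T1 * T2 -> R) y : bmeas f -> bmeas (fun x => f (x, y)).
Proof.
move=> [mf [M fM]]; split; last by exists M.
exact: measurableT_comp.
Qed.

Lemma bmeas_fst (f : T1 -> R) : bmeas f -> bmeas (fun z : T1 * T2 => f z.1).
Proof.
by move=> [mf [M fM]]; split; [exact: measurableT_comp|exists M].
Qed.

Lemma bmeas_prod_integrable (f : T1 * T2 -> R) : bmeas f ->
  (m1 \x m2)%E.-integrable setT (EFin \o f).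
Proof.
move=> [mf [M fM]]; apply: measurable_bounded_integrable => //.
- have := product_measure1E m1 m2 (@measurableT _ T1) (@measurableT _ T2).
  rewrite setXTT => h; apply: (@le_lt_trans _ _ (m1 setT * m2 setT)%E).
    by rewrite -h.
  rewrite lte_mul_pinfty ?fin_num_measure//.
  by rewrite ltey_eq fin_num_measure.
- exists M; split; first by rewrite num_real.
  by move=> x Mx y _ /=; rewrite (le_trans (fM y))// ltW.
Qed.

Lemma bmeas_int2 (f : T1 * T2 -> R) : bmeas f -> bmeas (fun x => \int[m2]_y f (x, y)).
Proof.
move=> bf; split.
  have := measurable_fubini_F (bmeas_prod_integrable bf).
  by move=> /(measurableT_comp (@fine_measurable _ _ measurableT)).
have [mf [M fM]] := bf.
exists (M * fine (m2 setT)) => x; apply: bint_absle => //.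
exact: bmeas_sec1.
Qed.

Lemma bmeas_int1 (f : T1 * T2 -> R) : bmeas f -> bmeas (fun y => \int[m1]_x f (x, y)).
Proof.
move=> bf; split.
  have := measurable_fubini_G (bmeas_prod_integrable bf).
  by move=> /(measurableT_comp (@fine_measurable _ _ measurableT)).
have [mf [M fM]] := bf.
exists (M * fine (m1 setT)) => x; apply: bint_absle => //.
exact: bmeas_sec2.
Qed.

Lemma bint_fubini (f : T1 * T2 -> R) : bmeas f ->
  \int[m1]_x (\int[m2]_y f (x, y)) = \int[m2]_y (\int[m1]_x f (x, y)).
Proof.
move=> bf.
transitivity (fine (\int[m1]_x \int[m2]_y (f (x, y))%:E)%E).
  by congr fine; apply: eq_integral => x _; rewrite EFin_bint//; exact: bmeas_sec1.
rewrite (Fubini (bmeas_prod_integrable bf)).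
by congr fine; apply: eq_integral => y _; rewrite EFin_bint//; exact: bmeas_sec2.
Qed.

End bounded_fubini.

(** * Hits: visits to a small neighbourhood of the integers *)

Section interval_measure.
Context {R : realType}.

(** Half-open intervals make [bint_leb_itv_split] an exact partition, and
    the variable [x] lives on one. *)
Definition leb_co (b c : R) : set R -> \bar R :=
  mrestr (@lebesgue_measure R) (measurable_itv `[b, c[).

Let leb_co0 b c : leb_co b c set0 = 0%E.
Proof. exact: measure0. Qed.

Let leb_co_ge0 b c A : (0 <= leb_co b c A)%E.
Proof. exact: measure_ge0. Qed.

Let leb_co_sigma_additive b c : semi_sigma_additive (leb_co b c).
Proof. exact: (@measure_semi_sigma_additive _ _ _
  (mrestr (@lebesgue_measure R) (measurable_itv `[b, c[))). Qed.

HB.instance Definition _ b c := isMeasure.Build _ _ _ (leb_co b c)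
  (leb_co0 b c) (leb_co_ge0 b c) (@leb_co_sigma_additive b c).

Let leb_co_fin b c : fin_num_fun (leb_co b c).
Proof.
move=> A mA; rewrite ge0_fin_numE//.
apply: (@le_lt_trans _ _ (@lebesgue_measure R `[b, c[%classic)).
  by apply: le_measure; rewrite ?inE//=; exact: measurableI.
rewrite lebesgue_measure_itv/=.
by case: ifP => _; rewrite ?ltry// -EFinB ltry.
Qed.

HB.instance Definition _ b c :=
  @Measure_isFinite.Build _ _ R (leb_co b c) (leb_co_fin b c).

Definition leb_itv b c : {finite_measure set R -> \bar R} := leb_co b c.

Lemma leb_itvT b c : b <= c -> fine (leb_itv b c setT) = c - b.
Proof.
move=> bc; rewrite /leb_itv/= /leb_co /mrestr setTI lebesgue_measure_itv/= lte_fin.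
case: ltP => // cb; have -> : b = c by apply/eqP; rewrite eq_le bc.
by rewrite subrr.
Qed.

Lemma bint_leb_itv_indic b c (A : set R) : measurable A ->
  \int[leb_itv b c]_x (\1_A x : R) = fine (lebesgue_measure (A `&` `[b, c[%classic)).
Proof. by move=> mA; rewrite /Rintegral integral_indic// setIT. Qed.

Lemma bint_leb_itv_split b p c (f : R -> R) : b <= p -> p <= c -> bmeas f ->
  \int[leb_itv b c]_x f x = \int[leb_itv b p]_x f x + \int[leb_itv p c]_x f x.
Proof.
move=> bp pc bf.
have mf : measurable_fun setT (EFin \o f) by apply/measurable_EFinP; case: bf.
rewrite /Rintegral (@eq_measure_integral _ _ _ _
  (measure_add (leb_itv b p) (leb_itv p c))).
  rewrite integral_measure_add//; [|exact: bmeas_integrable..].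
  by rewrite fineD//; apply: integrable_fin_num => //; exact: bmeas_integrable.
move=> A mA _; apply: (eq_trans _ (esym (measure_addE _ _ _))).
rewrite /= /leb_co /mrestr.
rewrite -measureU//; [|exact: measurableI..|].
  rewrite -setIUr; congr (lebesgue_measure (A `&` _)).
  by rewrite -(@itv_bndbnd_setU _ _ (BLeft b) (BLeft p) (BLeft c))// bnd_simp.
rewrite -subset0 => x []/= [_]; rewrite in_itv/= => /andP[_ xp] [_].
by rewrite in_itv/= leNgt xp.
Qed.

End interval_measure.

Section near_int.
Context {R : realType}.
Implicit Types w t x : R.

Definition near_int w : set R := [set t | exists n : int, `|t + n%:~R| <= w / 2].

Definition hit w t : R := \1_(near_int w) t.

Lemma measurable_near_int w : measurable (near_int w).
Proof.
have -> : near_int w = \bigcup_(n : int) (`[- (w / 2) - n%:~R, w / 2 - n%:~R]%classic).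
  apply/seteqP; split => t /=.
    move=> [n]; rewrite ler_norml => /andP[h1 h2]; exists n => //=.
    by rewrite in_itv/= lerBlDr h1/= lerBrDr.
  move=> [n _] /=; rewrite in_itv/= => /andP[h1 h2]; exists n.
  by rewrite ler_norml -lerBlDr h1/= -lerBrDr.
apply: countable_bigcupT_measurable => // n; exact: measurable_itv.
Qed.

Lemma hit_bmeas d (T : measurableType d) w (f : T -> R) : measurable_fun setT f ->
  bmeas (fun z => hit w (f z)).
Proof.
move=> mf; split.
  apply: (measurableT_comp (f := hit w)) => //.
  by apply: measurable_indic; exact: measurable_near_int.
exists 1 => z; rewrite /hit indicE; case: (_ \in _) => /=;
  by rewrite ?normr1// normr0.
Qed.

Lemma hitP w t : reflect (near_int w t) (t \in near_int w).
Proof. by apply: (iffP idP); rewrite inE. Qed.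

Lemma hit_ge0 w t : 0 <= hit w t. Proof. by rewrite /hit indicE. Qed.

Lemma hit_le1 w t : hit w t <= 1.
Proof. by rewrite /hit indicE lern1 leq_b1. Qed.

Lemma hitN w t : hit w (- t) = hit w t.
Proof.
rewrite /hit !indicE; congr (_%:R); congr nat_of_bool.
apply/idP/idP; rewrite !inE/= => -[n h]; exists (- n);
  by rewrite -normrN opprD mulrNz ?opprK in h *.
Qed.

Lemma hit_mono w w' t : w <= w' -> hit w t <= hit w' t.
Proof.
move=> ww'; rewrite /hit !indicE; case: hitP => [[n h]|_]; last by rewrite ler0n.
suff -> : t \in near_int w' by [].
by rewrite inE; exists n; rewrite (le_trans h)// ler_wpM2r// invr_ge0.
Qed.

(** Missing the integers means hitting the half-integers: upper bounds on the
    measure of hits, applied to the complementary width, give lower bounds. *)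
Lemma hit_compl w t : 1 <= hit w t + hit (1 - w) (t + 2^-1).
Proof.
rewrite /hit !indicE; case: hitP => [_|h]; first by rewrite lerDl ler0n.
suff -> : t + 2^-1 \in near_int (1 - w) by rewrite add0r.
rewrite inE; exists (- (Num.floor t + 1)).
have /andP[f0 f1] := floor_itv t; rewrite intrD in f1.
have h0 : w / 2 < t - (Num.floor t)%:~R.
  rewrite ltNge; apply/negP => h0; apply: h; exists (- Num.floor t).
  by rewrite mulrNz ger0_norm// subr_ge0.
have h1 : w / 2 < 1 - (t - (Num.floor t)%:~R).
  rewrite ltNge; apply/negP => h1; apply: h; exists (- (Num.floor t + 1)).
  rewrite mulrNz intrD ler0_norm; last by rewrite subr_le0 ltW.
  by lra.
by rewrite mulrNz intrD ler_norml; apply/andP; split; lra.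
Qed.

(** Two simultaneous hits force a hit by the difference of the two points; this
    decouples pairs of points once [x] has been integrated out. *)
Lemma hit_mul_le w t s : hit w t * hit w s <= hit w t * hit (2 * w) (s - t).
Proof.
rewrite /hit !indicE; case: hitP => [[n hn]|_]; last by rewrite !mul0r.
case: hitP => [[m hm]|_]; last by rewrite mulr0 mul1r ler0n.
suff -> : s - t \in near_int (2 * w) by [].
rewrite inE; exists (m - n); rewrite intrB.
have -> : s - t + (m%:~R - n%:~R) = s + m%:~R - (t + n%:~R) by ring.
rewrite (le_trans (ler_normB _ _))//; lra.
Qed.

(** The annulus between two windows is covered by two windows of half the
    difference of the widths, so that enlarging a window costs only that
    difference in mean. *)
Lemma hit_widen w1 w2 t :
  hit w2 t <= hit w1 t + hit ((w2 - w1) / 2) (t - (w1 + w2) / 4)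
              + hit ((w2 - w1) / 2) (t + (w1 + w2) / 4).
Proof.
set c := (w1 + w2) / 4; set e := (w2 - w1) / 2.
rewrite {1}/hit indicE; case: hitP => [[n hn]|_]; last first.
  by rewrite !addr_ge0// hit_ge0.
have [h|h] := leP `|t + n%:~R| (w1 / 2).
  have -> : hit w1 t = 1 by rewrite /hit indicE; case: hitP => // -[]; exists n.
  by rewrite -addrA lerDl addr_ge0// hit_ge0.
have [tn|tn] := leP 0 (t + n%:~R).
  have -> : hit e (t - c) = 1.
    rewrite /hit indicE; case: hitP => // -[]; exists n.
    move: hn h; rewrite ger0_norm// => h1 h2.
    by rewrite /e /c ler_norml; apply/andP; split; lra.
  by rewrite -addrA addrCA lerDl addr_ge0// hit_ge0.
have -> : hit e (t + c) = 1.
  rewrite /hit indicE; case: hitP => // -[]; exists n.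
  move: hn h; rewrite ltr0_norm// => h1 h2.
  by rewrite /e /c ler_norml; apply/andP; split; lra.
by rewrite lerDr addr_ge0// hit_ge0.
Qed.

(** An interval of length [c - b] meets at most [a (c - b) + w + 1] of the
    windows, which are spaced by [1 / a], and each takes up a length [w / a]. *)
Lemma int_hit_le (a b c w x : R) : 0 < a -> 0 <= w <= 1 -> b <= c ->
  \int[leb_itv b c]_y hit w (y * a + x) <= w * (c - b) + 2 * w / a.
Proof.
move=> a0 /andP[w0 w1] bc.
pose A := (fun y => y * a + x) @^-1` near_int w.
have mA : measurable A.
  rewrite -[A]setTI; apply: (_ : measurable_fun setT _) => //; last first.
    exact: measurable_near_int.
  by apply: measurable_funD => //; exact: measurable_funM.
have -> : \int[leb_itv b c]_y hit w (y * a + x) =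
    fine (lebesgue_measure (A `&` `[b, c[%classic)).
  by rewrite -bint_leb_itv_indic.
pose k0 : int := Num.ceil (a * b + x - w / 2).
pose K := Num.truncn (a * (c - b) + w + 1).
pose V i := `[(k0%:~R + i%:R - x - w / 2) / a, (k0%:~R + i%:R - x + w / 2) / a]%classic.
have vV i : lebesgue_measure (V i) = (w / a)%:E.
  rewrite /V lebesgue_measure_itv/= lte_fin ltr_pM2r ?invr_gt0//.
  rewrite ltrD2l; case: ltP => h; first by rewrite -EFinB -mulrBl; congr ((_ / _)%:E); lra.
  by have -> : w = 0; [lra|rewrite mul0r].
have sub : A `&` `[b, c[%classic `<=` \big[setU/set0]_(i < K) V i.
  move=> y [[n hn]] /=; rewrite in_itv/= => /andP[yb yc].
  rewrite ler_norml in hn; have /andP[hn1 hn2] := hn.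
  have yab : a * b <= y * a by rewrite mulrC ler_pM2r.
  have yac : y * a <= a * c by rewrite [leRHS]mulrC ler_pM2r// ltW.
  have kn : k0 <= - n.
    by rewrite ceil_le_int// intrN; lra.
  pose i := `|- n - k0|%N.
  have Ei : - n = k0 + i%:Z by rewrite /i gez0_abs ?subr_ge0//; ring.
  have Ein : - n%:~R = k0%:~R + i%:R :> R by rewrite -intrN Ei intrD.
  have k0l : a * b + x - w / 2 <= k0%:~R by exact: ceil_ge.
  have iK : (i < K)%N by rewrite truncn_gt_nat -natr1; lra.
  rewrite -bigcup_mkord; exists i => //=.
  by rewrite /V/= in_itv/= ler_pdivrMr// ler_pdivlMr// -Ein; apply/andP; split; lra.
have mV i : (i < K)%N -> measurable (V i) by move=> _; exact: measurable_itv.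
have mAI : measurable (A `&` `[b, c[%classic) by exact: measurableI.
have H : (lebesgue_measure (A `&` `[b, c[%classic) <= ((w / a) *+ K)%:E)%E.
  apply: le_trans
    (@content_subadditive _ _ _ (@lebesgue_measure R) _ V K mV mAI sub) _.
  rewrite (eq_bigr (fun=> (w / a)%:E)); last by move=> i _; exact: vV.
  by rewrite sumEFin sumr_const card_ord.
have fA : (lebesgue_measure (A `&` `[b, c[%classic) : \bar R) \is a fin_num.
  by rewrite ge0_fin_numE// (le_lt_trans H)// ltry.
rewrite -lee_fin fineK//; apply: (le_trans H); rewrite lee_fin.
have hK : K%:R <= a * (c - b) + w + 1.
  by rewrite truncn_le addr_ge0// addr_ge0// mulr_ge0// ?subr_ge0// ltW.
rewrite -[leLHS]mulr_natl.
apply: (@le_trans _ _ ((a * (c - b) + w + 1) * (w / a))).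
  by rewrite ler_wpM2r// divr_ge0// ltW.
have -> : (a * (c - b) + w + 1) * (w / a) = w * (c - b) + (w + 1) * w / a.
  by field; rewrite gt_eqF.
rewrite lerD2l ler_pM2r ?invr_gt0//; nra.
Qed.

Lemma measurable_affine (a x : R) : measurable_fun setT (fun y : R => y * a + x).
Proof. by apply: measurable_funD => //; exact: measurable_funM. Qed.

(** The oscillation estimate: on every interval, short or long, the integral of
    the centred hit is of the order of a single period. The lower bound is the
    upper bound for the complementary width. *)
Lemma int_hit_dev (a b c w x : R) : 0 < a -> 0 <= w <= 1 -> b <= c ->
  `|\int[leb_itv b c]_y (hit w (y * a + x) - w)| <= 2 / a.
Proof.
move=> a0 w01 bc; have /andP[w0 w1] := w01.
have mw x' w' : bmeas (fun y : R => hit w' (y * a + x')).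
  by apply: hit_bmeas; exact: measurable_affine.
have -> : \int[leb_itv b c]_y (hit w (y * a + x) - w) =
    \int[leb_itv b c]_y hit w (y * a + x) - w * (c - b).
  by rewrite bintB//; [rewrite bint_cst leb_itvT|exact: bmeas_cst].
have U := int_hit_le x a0 w01 bc.
have w'01 : 0 <= 1 - w <= 1 by apply/andP; split; lra.
have U' := int_hit_le (x + 2^-1) a0 w'01 bc.
have : \int[leb_itv b c]_(y in setT) 1 <= \int[leb_itv b c]_y hit w (y * a + x) +
     \int[leb_itv b c]_y hit (1 - w) (y * a + (x + 2^-1)).
  rewrite -bintD//; apply: bint_le; [exact: bmeas_cst|exact: bmeasD|].
  by move=> y; rewrite addrA hit_compl.
rewrite bint_cst leb_itvT// mul1r => L.
have ia : 0 < a^-1 by rewrite invr_gt0.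
have wa : w * a^-1 <= a^-1 by rewrite ler_piMl// ltW.
have wa0 : 0 <= w * a^-1 by rewrite mulr_ge0// ltW.
move: U U' L wa wa0 ia.
generalize (\int[leb_itv b c]_y hit w (y * a + x)) => I1.
generalize (\int[leb_itv b c]_y hit (1 - w) (y * a + (x + 2^-1))) => I2.
generalize (a^-1) => ia {mw w'01 w01 a0 bc} U U' L wa wa0 ia0.
by rewrite ler_norml; apply/andP; split; lra.
Qed.

Lemma int_hit_unit (w t : R) : 0 <= w <= 1 ->
  \int[leb_itv 0 1]_x hit w (t - x) <= 3 * w.
Proof.
move=> w01; under eq_Rintegral do rewrite -hitN opprB -[x in x - _]mulr1.
by rewrite (le_trans (int_hit_le (- t) ltr01 w01 ler01))//; lra.
Qed.

End near_int.

(** * Step functions against an oscillating factor *)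

Section jumps.
Context {R : realType}.
Implicit Types (b c M : R) (s : seq R) (f g : R -> R).

Definition locally_cst b c s f := forall y z, b < y -> y <= z -> z < c ->
  (forall p, p \in s -> ~~ (y <= p <= z)) -> f y = f z.

Definition jumps b c M f := exists2 s, (size s)%:R <= M & locally_cst b c s f.

Lemma jumps_cst b c k : jumps b c 0 (fun=> k).
Proof. by exists [::]. Qed.

Lemma jumps_op (F : R -> R -> R) b c M1 M2 f g : jumps b c M1 f -> jumps b c M2 g ->
  jumps b c (M1 + M2) (fun y => F (f y) (g y)).
Proof.
move=> [s hs cs] [t ht ct]; exists (s ++ t).
  by rewrite size_cat natrD lerD.
move=> y z bY yz zc H; rewrite (cs y z)// ?(ct y z)// => p ps; apply: H.
  by rewrite mem_cat ps orbT.
by rewrite mem_cat ps.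
Qed.

Lemma jumps_comp (F : R -> R) b c M f : jumps b c M f ->
  jumps b c M (fun y => F (f y)).
Proof. by move=> [s hs cs]; exists s => // y z *; rewrite (cs y z). Qed.

Lemma jumps_sum b c (I : eqType) (r : seq I) (M : I -> R) (f : I -> R -> R) :
  (forall i, i \in r -> jumps b c (M i) (f i)) ->
  jumps b c (\sum_(i <- r) M i) (fun y => \sum_(i <- r) f i y).
Proof.
elim: r => [_|i r IH H].
  by rewrite big_nil; under eq_fun do rewrite big_nil; exact: jumps_cst.
rewrite big_cons.
have -> : (fun y => \sum_(j <- i :: r) f j y) =
    (fun y => f i y + \sum_(j <- r) f j y).
  by apply/funext => y; rewrite big_cons.
apply: jumps_op; first by apply: H; rewrite inE eqxx.
by apply: IH => j jr; apply: H; rewrite inE jr orbT.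
Qed.

(** The jumps are the edges of the windows met inside the interval. *)
Lemma jumps_hit (a b c w x : R) : 0 < a -> 0 <= w <= 1 -> b <= c ->
  jumps b c (2 * (a * (c - b) + 2)) (fun y => hit w (y * a + x)).
Proof.
move=> a0 /andP[w0 w1] bc.
pose k0 : int := Num.ceil (a * b + x - w / 2).
pose K := Num.truncn (a * (c - b) + w + 1).
pose edge e (i : nat) : R := (k0%:~R + i%:R + e - x) / a.
have k0l : a * b + x - w / 2 <= k0%:~R by exact: ceil_ge.
exists (map (edge (w / 2)) (iota 0 K) ++ map (edge (- (w / 2))) (iota 0 K)).
  rewrite size_cat !size_map !size_iota natrD.
  have : K%:R <= a * (c - b) + w + 1.
    by rewrite truncn_le addr_ge0// addr_ge0// mulr_ge0// ?subr_ge0// ltW.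
  by lra.
(* a window centred at [k] that is met inside [b, c] is one of the [K] listed *)
have key y : b < y -> y < c -> near_int w (y * a + x) ->
    exists2 i, i \in iota 0 K & `|y * a + x - (k0%:~R + i%:R)| <= w / 2.
  move=> yb yc [n hn].
  have /andP[hn1 hn2] : - (w / 2) <= y * a + x + n%:~R <= w / 2 by rewrite -ler_norml.
  have yab : a * b <= y * a by rewrite mulrC ler_pM2r// ltW.
  have yac : y * a <= a * c by rewrite [leRHS]mulrC ler_pM2r// ltW.
  have kn : k0 <= - n.
    by rewrite ceil_le_int// intrN; lra.
  pose i := `|- n - k0|%N.
  have Ei : - n = k0 + i%:Z by rewrite /i gez0_abs ?subr_ge0//; ring.
  have Ein : - n%:~R = k0%:~R + i%:R :> R by rewrite -intrN Ei intrD.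
  exists i; last by rewrite -Ein opprK.
  by rewrite mem_iota add0n leq0n /= truncn_gt_nat -natr1; lra.
move=> y z yb yz zc H.
rewrite /hit !indicE; congr (_%:R); congr nat_of_bool.
have yza : y * a <= z * a by rewrite ler_pM2r.
have yc : y < c by exact: le_lt_trans yz zc.
have zb : b < z by exact: lt_le_trans yb yz.
apply/idP/idP; rewrite !inE => hy.
  have [i ii hi] := key y yb yc hy.
  have /negP : ~~ (y <= edge (w / 2) i <= z).
    by apply: H; rewrite mem_cat map_f.
  rewrite /edge ler_pdivlMr// ler_pdivrMr// => N.
  exists (- (k0 + i%:Z)); rewrite mulrNz intrD.
  move: hi; rewrite !ler_norml => /andP[h1 h2]; apply/andP; split.
    by rewrite (le_trans h1)//; lra.
  rewrite leNgt; apply/negP => h3; apply: N.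
  by apply/andP; split; lra.
have [i ii hi] := key z zb zc hy.
have /negP : ~~ (y <= edge (- (w / 2)) i <= z).
  by apply: H; rewrite mem_cat map_f// orbT.
rewrite /edge ler_pdivlMr// ler_pdivrMr// => N.
exists (- (k0 + i%:Z)); rewrite mulrNz intrD.
move: hi; rewrite !ler_norml => /andP[h1 h2]; apply/andP; split; last first.
  by apply: le_trans h2; lra.
rewrite leNgt; apply/negP => h3; apply: N.
by apply/andP; split; lra.
Qed.

(** Splitting at a jump and inducting reduces to an interval on whose interior
    [f] is constant; there [f] comes out of the integral, up to its value at the
    left endpoint, a null set. *)
Lemma int_mul_jumps_seq b c s f g (B : R) : b <= c -> bmeas f -> bmeas g ->
  (forall y, `|f y| <= 1) -> locally_cst b c s f ->
  (forall p q, b <= p -> p <= q -> q <= c -> `|\int[leb_itv p q]_y g y| <= B) ->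
  `|\int[leb_itv b c]_y (g y * f y)| <= (size s).+1%:R * B.
Proof.
have [n] := ubnP (size s); elim: n s b c => // n IH s b c sn bc bf bg f1 cf gB.
have B0 : 0 <= B by apply: le_trans (gB b b _ _ _); rewrite ?normr_ge0.
have [/hasP[p ps /andP[bp pc]]|ns] := boolP (has (fun p => b < p < c) s).
  pose s1 := [seq q <- s | q < p]; pose s2 := [seq q <- s | p < q].
  have sz : (size s1 + size s2 < size s)%N.
    have szE t : (count (fun q => (q < p)%R) t + count (fun q => (p < q)%R) t +
        count (pred1 p) t = size t)%N.
      by elim: t => //= q t <-; case: (ltgtP q p) => _ /=; lia.
    by rewrite !size_filter -(szE s) -[ltnLHS]addn0 ltn_add2l -has_count has_pred1.
  have h1 : `|\int[leb_itv b p]_y (g y * f y)| <= (size s1).+1%:R * B.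
    apply: IH => //; [|exact: ltW| |].
    - by rewrite -ltnS (leq_trans _ sn)// ltnS (leq_ltn_trans (leq_addr _ _) sz).
    - move=> y z by_ yz zp H; apply: cf => //; first exact: lt_trans zp pc.
      move=> q qs; have [qp|pq] := ltP q p; first by apply: H; rewrite mem_filter qp.
      by rewrite negb_and -!ltNge (lt_le_trans zp pq) orbT.
    - by move=> p' q h h' h''; apply: gB => //; rewrite (le_trans h'')// ltW.
  have h2 : `|\int[leb_itv p c]_y (g y * f y)| <= (size s2).+1%:R * B.
    apply: IH => //; [|exact: ltW| |].
    - by rewrite -ltnS (leq_trans _ sn)// ltnS (leq_ltn_trans (leq_addl _ _) sz).
    - move=> y z py yz zc H; apply: cf => //; first exact: lt_trans bp py.
      move=> q qs; have [qp|pq] := ltP p q; first by apply: H; rewrite mem_filter qp.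
      by rewrite negb_and -!ltNge (le_lt_trans pq py).
    - by move=> p' q h h' h''; apply: gB => //; rewrite (le_trans _ h)// ltW.
  rewrite (bint_leb_itv_split (ltW bp) (ltW pc)); last exact: bmeasM.
  rewrite (le_trans (ler_normD _ _))// (le_trans (lerD h1 h2))//.
  by rewrite -mulrDl ler_wpM2r// -natrD ler_nat addSn addnS !ltnS.
have [<-{c bc cf gB ns}|bltc] := eqVneq b c.
  rewrite (le_trans (bint_abs _ (bmeasM bg bf)))//.
  have [_ [K fK]] := bmeasM bg bf.
  rewrite (le_trans (bint_le _ (bmeas_norm (bmeasM bg bf)) (bmeas_cst K) fK))//.
  by rewrite bint_cst leb_itvT// subrr mulr0 mulr_ge0.
have {}bltc : b < c by rewrite lt_neqAle bltc.
pose m := (b + c) / 2.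
have bm : b < m by rewrite /m; lra.
have mc : m < c by rewrite /m; lra.
have fm y : b < y -> y < c -> f y = f m.
  move=> yb yc; have [ym|my] := leP y m.
    apply: cf => // p ps; apply/negP => /andP[h1 h2].
    move/hasPn : ns => /(_ p ps) /negP; apply.
    by rewrite (lt_le_trans yb h1) (le_lt_trans h2 mc).
  apply/esym/cf => //; [exact: ltW|]; move=> p ps; apply/negP => /andP[h1 h2].
  move/hasPn : ns => /(_ p ps) /negP; apply.
  by rewrite (lt_le_trans bm h1) (le_lt_trans h2 yc).
pose D y := g y * f y - f m * g y.
have bD : bmeas D by apply: bmeasB; apply: bmeasM => //; exact: bmeas_cst.
have D0 : \int[leb_itv b c]_y D y = 0.
  have [_ [K DK]] := bD.
  have mN : measurable ([set b] `|` ~` `[b, c[%classic).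
    by apply: measurableU => //; apply: measurableC; exact: measurable_itv.
  have b1 : bmeas (\1_([set b] `|` ~` `[b, c[%classic) : R -> R).
    split; first exact: measurable_indic.
    exists 1 => z; rewrite indicE; case: (_ \in _) => /=;
      by rewrite ?normr1// normr0.
  have K0 : 0 <= K by exact: le_trans (normr_ge0 _) (DK 0).
  apply/eqP; rewrite -normr_le0 (le_trans (bint_abs _ bD))//.
  have le1 : \int[leb_itv b c]_y `|D y| <=
      \int[leb_itv b c]_y (K * (\1_([set b] `|` ~` `[b, c[%classic) y)).
    apply: bint_le; [exact: bmeas_norm|apply: bmeasM => //; exact: bmeas_cst|].
    move=> y; rewrite indicE.
    case: (boolP (y \in [set b] `|` ~` `[b, c[%classic)) => [_|].
      by rewrite mulr1; exact: DK.
    rewrite notin_setE => /= /not_orP[yb /contrapT].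
    rewrite in_itv/= => /andP[by_ yc].
    have {}yb : b < y by rewrite lt_neqAle by_ andbT; apply/eqP => e; apply: yb.
    by rewrite /D (fm _ yb yc) mulrC subrr normr0 mulr_ge0.
  rewrite (le_trans le1)// bintZ// bint_leb_itv_indic// setIUl setICl setU0.
  have -> : ([set b] `&` `[b, c[%classic) = [set b].
    by rewrite setIidl// => z ->; rewrite /= in_itv/= lexx.
  by rewrite lebesgue_measure_set1/= mulr0.
have -> : \int[leb_itv b c]_y (g y * f y) = f m * \int[leb_itv b c]_y g y.
  apply/eqP; rewrite -subr_eq0 -bintZ// -bintB//; first by rewrite [X in X == _]D0.
    exact: bmeasM.
  by apply: bmeasM => //; exact: bmeas_cst.
rewrite normrM (le_trans (ler_pM _ _ (f1 m) (gB b c _ _ _)))//.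
by rewrite ler_wpM2r// ler1n.
Qed.

Lemma int_mul_jumps b c M f g (B : R) : b <= c -> bmeas f -> bmeas g ->
  (forall y, `|f y| <= 1) -> jumps b c M f ->
  (forall p q, b <= p -> p <= q -> q <= c -> `|\int[leb_itv p q]_y g y| <= B) ->
  `|\int[leb_itv b c]_y (g y * f y)| <= (M + 1) * B.
Proof.
move=> bc bf bg f1 [s sM cs] gB.
have B0 : 0 <= B by apply: le_trans (gB b b _ _ _); rewrite ?normr_ge0.
rewrite (le_trans (int_mul_jumps_seq bc bf bg f1 cs gB))//.
by rewrite ler_wpM2r// -natr1 lerD2r.
Qed.

End jumps.

(** * Second moment of a sum of weakly dependent averages *)

Section second_moment.
Context {d1 d2 : measure_display} {TA : measurableType d1} {TX : measurableType d2}
  {R : realType}.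
Variables (mA : {finite_measure set TA -> \bar R})
          (mX : {finite_measure set TX -> \bar R}).

(** Fubini, with an independent copy of [x] for the second factor: the bound has
    to hold for each pair of values of [x], only the integral over [a] has
    cancellations. *)
Lemma cross_moment (f g : TA * TX -> R) (e : R) : bmeas f -> bmeas g ->
  (forall x x', `|\int[mA]_a (f (a, x) * g (a, x'))| <= e) ->
  `|\int[mA]_a ((\int[mX]_x f (a, x)) * (\int[mX]_x g (a, x)))| <=
    e * fine (mX setT) ^+ 2.
Proof.
move=> bf bg H.
have bG : bmeas (fun a => \int[mX]_x g (a, x)) by exact: (bmeas_int2 mA mX).
have bfG : bmeas (fun z : TA * TX => f z * \int[mX]_x g (z.1, x)).
  apply: bmeasM => //.
  exact: (bmeas_fst (T1 := TA) (T2 := TX) (f := fun a => \int[mX]_x g (a, x))).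
have -> : \int[mA]_a ((\int[mX]_x f (a, x)) * (\int[mX]_x g (a, x))) =
    \int[mX]_x \int[mA]_a (f (a, x) * \int[mX]_x g (a, x)).
  rewrite -(bint_fubini mA mX bfG) /=.
  by apply: eq_Rintegral => a _; rewrite bintZr//; exact: bmeas_sec1.
rewrite expr2 mulrA; apply: bint_absle => [|x].
  exact: (bmeas_int1 mA mX bfG).
have bfg : bmeas (fun z : TA * TX => f (z.1, x) * g z).
  apply: bmeasM => //.
  by apply: (bmeas_fst (T1 := TA) (T2 := TX) (f := fun a => f (a, x))); exact: bmeas_sec2.
have -> : \int[mA]_a (f (a, x) * \int[mX]_x g (a, x)) =
    \int[mX]_x' \int[mA]_a (f (a, x) * g (a, x')).
  rewrite -(bint_fubini mA mX bfg) /=.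
  by apply: eq_Rintegral => a _; rewrite bintZ//; exact: bmeas_sec1.
apply: bint_absle => [|x'].
  exact: (bmeas_int1 mA mX bfg).
exact: H.
Qed.

Lemma count_near (N D j : nat) :
  (count (fun i => (j < i + D) && (i < j + D))%N (index_iota 1 N.+1) <= 2 * D)%N.
Proof.
rewrite -size_filter -(size_iota (j.+1 - D) (2 * D)).
apply: uniq_leq_size; first by rewrite filter_uniq// iota_uniq.
move=> i; rewrite mem_filter mem_iota => /andP[/andP[h1 h2] _].
by apply/andP; split; lia.
Qed.

(** Only the [2 D N] pairs of neighbouring indices escape the bound on
    correlations; for those the trivial bound is used. *)
Lemma second_moment (N D : nat) (f : nat -> TA * TX -> R) (b e : R) :
  0 <= e -> (forall j, bmeas (f j)) ->
  (forall j a, `|\int[mX]_x f j (a, x)| <= b) ->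
  (forall i j, (0 < i)%N -> (i + D <= j)%N -> (j <= N)%N -> forall x x',
     `|\int[mA]_a (f j (a, x) * f i (a, x'))| <= e) ->
  \int[mA]_a (\sum_(1 <= j < N.+1) \int[mX]_x f j (a, x)) ^+ 2 <=
    (2 * D)%:R * N%:R * (b ^+ 2 * fine (mA setT))
    + N%:R ^+ 2 * (e * fine (mX setT) ^+ 2).
Proof.
move=> e0 bf fb far.
pose M j a := \int[mX]_x f j (a, x).
have bM j : bmeas (M j) by exact: (bmeas_int2 mA mX).
set E1 := b ^+ 2 * fine (mA setT); set E2 := e * fine (mX setT) ^+ 2.
have E10 : 0 <= E1 by rewrite mulr_ge0 ?sqr_ge0// fine_ge0.
have E20 : 0 <= E2 by rewrite mulr_ge0// sqr_ge0.
have pair i j : i \in index_iota 1 N.+1 -> j \in index_iota 1 N.+1 ->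
   \int[mA]_a (M j a * M i a) <= ((j < i + D) && (i < j + D))%N%:R * E1 + E2.
  rewrite !mem_index_iota !ltnS => /andP[i0 iN] /andP[j0 jN].
  apply: le_trans (ler_norm _) _.
  have [/andP[h1 h2]|] := boolP (_ && _).
    rewrite mul1r (@le_trans _ _ E1)// ?lerDl//.
    apply: bint_absle => [|a]; first exact: bmeasM.
    by rewrite normrM expr2 ler_pM//; exact: fb.
  rewrite mul0r add0r negb_and -!leqNgt => /orP[h|h].
    by apply: cross_moment => // x x'; exact: far.
  under eq_Rintegral do rewrite mulrC.
  by apply: cross_moment => // x x'; exact: far.
have -> : \int[mA]_a (\sum_(1 <= j < N.+1) \int[mX]_x f j (a, x)) ^+ 2 =
   \sum_(1 <= j < N.+1) \sum_(1 <= i < N.+1) \int[mA]_a (M j a * M i a).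
  transitivity (\int[mA]_a \sum_(1 <= j < N.+1) \sum_(1 <= i < N.+1) (M j a * M i a)).
    apply: eq_Rintegral => a _; rewrite expr2 mulr_suml.
    by apply: eq_bigr => j _; rewrite mulr_sumr.
  rewrite bint_sum; last by move=> j _ _; apply: bmeas_sum => i _ _; exact: bmeasM.
  by apply: eq_bigr => j _; rewrite bint_sum// => i _ _; exact: bmeasM.
apply: (@le_trans _ _ (\sum_(1 <= j < N.+1) \sum_(1 <= i < N.+1)
    (((j < i + D) && (i < j + D))%N%:R * E1 + E2))).
  rewrite big_seq [leRHS]big_seq; apply: ler_sum => j jN.
  rewrite big_seq [leRHS]big_seq; apply: ler_sum => i iN.
  exact: pair.
apply: (@le_trans _ _ (\sum_(1 <= j < N.+1) ((2 * D)%:R * E1 + N%:R * E2))).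
  apply: ler_sum => j _; rewrite big_split/= lerD//.
    rewrite -mulr_suml ler_wpM2r// -natr_sum ler_nat.
    by rewrite -big_mkcond sum1_count count_near.
  by rewrite sumr_const_nat subn1 mulr_natl.
rewrite sumr_const_nat subn1 -[leLHS]mulr_natl.
by rewrite le_eqVlt; apply/orP; left; apply/eqP; ring.
Qed.

End second_moment.

(** * Taylor bounds *)

Section taylor.
Context {R : realType}.

Lemma mvt_le (P : set R) (f f1 : R -> R) (K a b : R) : is_interval P ->
  (forall t, P t -> is_derive t 1 f (f1 t)) ->
  (forall t, P t -> `|f1 t| <= K) -> P a -> P b ->
  `|f b - f a| <= K * `|b - a|.
Proof.
move=> iP df f1K Pa Pb; wlog ab : a b Pa Pb / a <= b.
  move=> W; have [ab|/ltW ba] := leP a b; first exact: W.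
  by rewrite distrC (distrC b); exact: W.
have Pab t : t \in `[a, b] -> P t by rewrite in_itv; exact: iP Pa Pb t.
have [t tab ->] := @MVT_segment R f f1 a b ab
  (fun t h => df t (Pab _ (subset_itv_oo_cc h)))
  (derivable_within_continuous (fun t h => @ex_derive _ _ _ _ _ _ _ (df t (Pab _ h)))).
by rewrite normrM ler_wpM2r//; apply: f1K; exact: Pab.
Qed.

(* restricting to points no farther than [b] turns a bound in [|t - a|] into one
   in [|b - a|] *)
Let between (P : set R) (a b : R) : set R := P `&` [set t | `|t - a| <= `|b - a|].

Let between_interval P a b : is_interval P -> is_interval (between P a b).
Proof.
move=> iP x y [Px xa] [Py ya] z xzy; split; first exact: iP Px Py z xzy.
move: xzy xa ya; rewrite /= !ler_norml => /andP[h1 h2] /andP[h3 h4] /andP[h5 h6].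
by apply/andP; split; lra.
Qed.

Lemma taylor2_le (P : set R) (f f1 f2 : R -> R) (K a b : R) : is_interval P ->
  (forall t, P t -> is_derive t 1 f (f1 t)) ->
  (forall t, P t -> is_derive t 1 f1 (f2 t)) ->
  (forall t, P t -> `|f2 t| <= K) -> P a -> P b ->
  `|f b - f a - (b - a) * f1 a| <= K * `|b - a| ^+ 2.
Proof.
move=> iP df df1 f2K Pa Pb.
have K0 : 0 <= K by exact: le_trans (normr_ge0 _) (f2K a Pa).
pose h t := f t - (t - a) * f1 a.
have -> : f b - f a - (b - a) * f1 a = h b - h a by rewrite /h; ring.
rewrite expr2 mulrA.
apply: (mvt_le (P := between P a b) (f1 := fun t => f1 t - f1 a)).
- exact: between_interval.
- move=> t [Pt _]; rewrite /h; have dt := df t Pt.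
  by apply: is_derive_eq; rewrite /GRing.scale/=; ring.
- move=> t [Pt ta]; apply: (@le_trans _ _ (K * `|t - a|)).
    exact: (mvt_le iP df1).
  by rewrite ler_wpM2l.
- by split => //=; rewrite subrr normr0.
- by split => /=.
Qed.

Lemma taylor3_le (P : set R) (f f1 f2 f3 : R -> R) (K a b : R) : is_interval P ->
  (forall t, P t -> is_derive t 1 f (f1 t)) ->
  (forall t, P t -> is_derive t 1 f1 (f2 t)) ->
  (forall t, P t -> is_derive t 1 f2 (f3 t)) ->
  (forall t, P t -> `|f3 t| <= K) -> P a -> P b ->
  `|f b - f a - (b - a) * f1 a - (b - a) ^+ 2 / 2 * f2 a| <= K * `|b - a| ^+ 3.
Proof.
move=> iP df df1 df2 f3K Pa Pb.
have K0 : 0 <= K by exact: le_trans (normr_ge0 _) (f3K a Pa).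
pose h t := f t - (t - a) * f1 a - (t - a) ^+ 2 * (f2 a / 2).
have -> : f b - f a - (b - a) * f1 a - (b - a) ^+ 2 / 2 * f2 a = h b - h a.
  by rewrite /h; field.
rewrite exprSr mulrA.
apply: (mvt_le (P := between P a b)
  (f1 := fun t => f1 t - f1 a - (t - a) * f2 a)).
- exact: between_interval.
- move=> t [Pt _]; rewrite /h; have dt := df t Pt.
  by apply: is_derive_eq; rewrite /GRing.scale/=; field.
- move=> t [Pt ta]; apply: (@le_trans _ _ (K * `|t - a| ^+ 2)).
    exact: (taylor2_le iP df1 df2).
  by rewrite ler_wpM2l// lerXn2r ?nnegrE.
- by split => //=; rewrite subrr normr0.
- by split => /=.
Qed.

End taylor.

(** * The normal distribution function *)

Section gaussian_cdf.
Context {R : realType}.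

Definition gdens (t : R) : R := (Num.sqrt (2 * pi))^-1 * expR (- (t ^+ 2) / 2).

Let mu := @lebesgue_measure R.

Definition gcdf (z : R) : R := \int[mu]_(t in `]-oo, z]) gdens t.

Lemma gdensE : gdens = normal_pdf 0 1.
Proof.
rewrite normal_pdfE ?oner_eq0//; apply/funext => t.
rewrite /gdens /normal_peak /normal_fun expr1n mul1r subr0.
by rewrite -[pi *+ 2]mulr_natl.
Qed.

Lemma gdens_ge0 t : 0 <= gdens t.
Proof. by rewrite gdensE normal_pdf_ge0. Qed.

Lemma gdens_integrable (A : set R) : measurable A -> mu.-integrable A (EFin \o gdens).
Proof.
move=> mA; rewrite gdensE; apply: (integrableS measurableT) => //.
exact: integrable_normal_pdf.
Qed.

Lemma gdens_continuous : continuous gdens.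
Proof. by rewrite gdensE; apply: continuous_normal_pdf; rewrite oner_eq0. Qed.

#[global] Instance is_derive_gcdf (z : R) : is_derive z 1 gcdf (gdens z).
Proof.
have [] := @continuous_FTC1 R gdens -oo%O z (z + 1) _ _ _ (@gdens_continuous z).
- by rewrite ltrDl.
- exact: gdens_integrable.
- by rewrite ltNyr.
- by move=> dz e; apply: DeriveDef; [exact: dz|rewrite -derive1E; exact: e].
Qed.

Lemma gcdfE z : (gcdf z)%:E = normal_prob (0 : R) 1 `]-oo, z]%classic.
Proof.
rewrite /normal_prob -gdensE /gcdf /Rintegral fineK//.
by apply: integrable_fin_num => //; exact: gdens_integrable.
Qed.

Lemma gcdf_ge0 z : 0 <= gcdf z.
Proof. by apply: Rintegral_ge0 => t _; exact: gdens_ge0. Qed.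

Lemma gcdf_le1 z : gcdf z <= 1.
Proof. by rewrite -lee_fin gcdfE probability_le1. Qed.

Lemma gcdf_mono x y : x <= y -> gcdf x <= gcdf y.
Proof.
move=> xy; rewrite -lee_fin !gcdfE; apply: le_measure; rewrite ?inE//.
by apply: subset_itvl; rewrite bnd_simp.
Qed.

Lemma gcdf_sub x y : x <= y -> gcdf y - gcdf x =
  \int[mu]_(t in `[x, y]) gdens t.
Proof.
move=> xy; rewrite /gcdf Rintegral_itvB ?bnd_simp//; last exact: gdens_integrable.
by rewrite Rintegral_itv_obnd_cbnd//; exact: gdens_integrable.
Qed.

Let idTR : measurableTypeR R -> R := idfun.

#[local] HB.instance Definition _ :=
  @isMeasurableFun.Build _ _ _ _ idTR (@measurable_id _ _ setT).

Let P : probability (measurableTypeR R) R := normal_prob (0 : R) 1.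

Let cdfE z : cdf (idTR : {RV P >-> R}) z = (gcdf z)%:E.
Proof. by rewrite gcdfE /cdf. Qed.

Lemma gcdf_cvgy : gcdf z @[z --> +oo] --> (1 : R).
Proof.
have := @cvg_cdfy1 _ _ _ P (idTR : {RV P >-> R}).
rewrite (_ : cdf _ = EFin \o gcdf); last by apply/funext => z; rewrite /= -cdfE.
by move=> /fine_cvgP[_].
Qed.

Lemma gcdf_cvgNy : gcdf z @[z --> -oo] --> (0 : R).
Proof.
have := @cvg_cdfNy0 _ _ _ P (idTR : {RV P >-> R}).
rewrite (_ : cdf _ = EFin \o gcdf); last by apply/funext => z; rewrite /= -cdfE.
by move=> /fine_cvgP[_].
Qed.

Lemma gcdf_tails (e : R) : 0 < e ->
  exists2 z : R, 0 < z & gcdf (- z) <= e /\ 1 - e <= gcdf z.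
Proof.
move=> e0.
have /cvgrPdist_le/(_ e e0)[M1 [_ H1]] := gcdf_cvgy.
have /cvgrPdist_le/(_ e e0)[M2 [_ H2]] := gcdf_cvgNy.
exists (Num.max 1 (Num.max (M1 + 1) (- M2 + 1))).
  by rewrite lt_max ltr01.
set z := Num.max _ _; have zM1 : M1 < z by rewrite /z !lt_max ltrDl ltr01 orbT.
have zM2 : - z < M2 by rewrite ltrNl /z !lt_max ltrDl ltr01 !orbT.
split.
  have := H2 _ zM2; rewrite sub0r normrN => /(le_trans (ler_norm _)); exact.
have := H1 _ zM1 => /(le_trans (ler_norm _)); lra.
Qed.

Lemma gdens_le t : gdens t <= expR (- (t ^+ 2 / 2)).
Proof.
rewrite /gdens mulNr ler_piMl ?expR_ge0// invf_le1.
  rewrite -[leLHS]sqrtr1 ler_wsqrtr//.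
  have := @pi_ge2 R; lra.
by rewrite sqrtr_gt0 mulr_gt0// pi_gt0.
Qed.

Let expR_lb (s : R) : 0 <= s -> s ^+ 2 / 4 <= expR s.
Proof.
move=> s0; have h : s / 2 <= expR (s / 2).
  by apply: le_trans (expR_ge1Dx _); rewrite lerDr.
have -> : s ^+ 2 / 4 = (s / 2) * (s / 2) by field.
have -> : expR s = expR (s / 2) * expR (s / 2).
  by rewrite -expRD; congr expR; field.
by apply: ler_pM => //; rewrite divr_ge0.
Qed.

Lemma gdens_le1 t : gdens t <= 1.
Proof.
rewrite (le_trans (gdens_le t))// -[leRHS]expR0 ler_expR oppr_le0.
by rewrite divr_ge0// sqr_ge0.
Qed.

Lemma gdens_mul2 t : t ^+ 2 * gdens t <= 2.
Proof.
apply: (@le_trans _ _ (t ^+ 2 * expR (- (t ^+ 2 / 2)))).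
  by rewrite ler_wpM2l ?sqr_ge0// gdens_le.
rewrite expRN ler_pdivrMr ?expR_gt0//.
have := expR_ge1Dx (t ^+ 2 / 2); lra.
Qed.

Lemma gdens_mul4 t : t ^+ 4 * gdens t <= 16.
Proof.
apply: (@le_trans _ _ (t ^+ 4 * expR (- (t ^+ 2 / 2)))).
  by rewrite ler_wpM2l ?exprn_even_ge0// gdens_le.
rewrite expRN ler_pdivrMr ?expR_gt0//.
have := @expR_lb (t ^+ 2 / 2) (divr_ge0 (sqr_ge0 _) (ler0n _ _)).
have -> : (t ^+ 2 / 2) ^+ 2 / 4 = t ^+ 4 / 16 by field.
lra.
Qed.

End gaussian_cdf.

(** * The heat flow of the normal distribution function *)

Section heat.
Context {R : realType}.

(** [q ^ (-1/2)], written so that it is differentiated by the rules for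
    exponential and logarithm. *)
Definition isd (q : R) : R := expR (- (ln q / 2)).

Lemma isd_gt0 q : 0 < isd q. Proof. exact: expR_gt0. Qed.

Lemma isd_ge0 q : 0 <= isd q. Proof. exact: expR_ge0. Qed.

Lemma isd_sqr q : 0 < q -> isd q ^+ 2 = q^-1.
Proof.
move=> q0; rewrite /isd expr2 -expRD -opprD -splitr expRN lnK//.
Qed.

Lemma isd1 : isd 1 = 1.
Proof. by rewrite /isd ln1 mul0r oppr0 expR0. Qed.

Lemma isd_le p q : 0 < p -> p <= q -> isd q <= isd p.
Proof.
move=> p0 pq; rewrite ler_expR lerN2 ler_pM2r// ler_ln// ?posrE//.
exact: lt_le_trans pq.
Qed.

Lemma is_derive_isd (q : R) : 0 < q -> is_derive q 1 isd (- (isd q ^+ 3 / 2)).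
Proof.
move=> q0; have dln := is_derive1_ln q0.
rewrite /isd; apply: is_derive_eq; rewrite /GRing.scale/= -/(isd q).
have -> : isd q ^+ 3 = isd q / q by rewrite exprS isd_sqr.
by field; rewrite gt_eqF.
Qed.

Lemma is_derive_gdens (t : R) : is_derive t 1 gdens (- (t * gdens t)).
Proof.
by rewrite /gdens; apply: is_derive_eq; rewrite /GRing.scale/=; field;
  rewrite gt_eqF// sqrtr_gt0 mulr_gt0// pi_gt0.
Qed.

(** The probability that [y] plus a centred Gaussian variable of variance [q]
    stays below [v]: the solution of the heat equation
    [d/dq = (1/2) d^2/dy^2] whose initial value is the indicator of [y <= v]. *)
Definition heat (v q y : R) : R := gcdf ((v - y) * isd q).

Lemma heat_ge0 v q y : 0 <= heat v q y. Proof. exact: gcdf_ge0. Qed.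

Lemma heat_le1 v q y : heat v q y <= 1. Proof. exact: gcdf_le1. Qed.

Section derivatives.
Variable v : R.

Let z q y := (v - y) * isd q.
(* [h1], [h2], [h3] are the derivatives in [y]; those in [q] are [h2 / 2] and
   [k2] *)
Let h1 q y := - isd q * gdens (z q y).
Let h2 q y := - (isd q ^+ 2 * (z q y * gdens (z q y))).
Let h3 q y := isd q ^+ 3 * ((1 - z q y ^+ 2) * gdens (z q y)).
Let k2 q y := isd q ^+ 4 / 4 * ((3 * z q y - z q y ^+ 3) * gdens (z q y)).

Let dz_y q (y : R) : is_derive y 1 (z q) (- isd q).
Proof. by rewrite /z; apply: is_derive_eq; rewrite /GRing.scale/=; ring. Qed.

Let dz_q (q y : R) : 0 < q -> is_derive q 1 (z ^~ y) (- (z q y * isd q ^+ 2 / 2)).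
Proof.
move=> q0; have d := is_derive_isd q0.
by rewrite /z; apply: is_derive_eq; rewrite /GRing.scale/=; field.
Qed.

Let dg_y q (y : R) : is_derive y 1 (gdens \o z q) (z q y * gdens (z q y) * isd q).
Proof.
by apply: (is_derive_eq (is_derive1_comp (is_derive_gdens (z q y)) (dz_y q y))); ring.
Qed.

Let dg_q (q y : R) : 0 < q -> is_derive q 1 (gdens \o (z ^~ y))
  (z q y ^+ 2 * gdens (z q y) * isd q ^+ 2 / 2).
Proof.
move=> q0.
by apply: (is_derive_eq (is_derive1_comp (g := z ^~ y)
  (is_derive_gdens (z q y)) (dz_q y q0))); field.
Qed.

Let dh_y q (y : R) : is_derive y 1 (heat v q) (h1 q y).
Proof.
by apply: (is_derive_eq (is_derive1_comp (is_derive_gcdf (z q y)) (dz_y q y)));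
  rewrite /h1; ring.
Qed.

Let dh1_y q (y : R) : is_derive y 1 (h1 q) (h2 q y).
Proof.
have d1 := dg_y q y.
rewrite (_ : h1 q = (fun y => - isd q * (gdens \o z q) y))//.
by apply: is_derive_eq; rewrite /GRing.scale/= /h2; ring.
Qed.

Let dh2_y q (y : R) : is_derive y 1 (h2 q) (h3 q y).
Proof.
have d0 := dz_y q y; have d1 := dg_y q y.
rewrite (_ : h2 q = (fun y => - (isd q ^+ 2 * (z q y * (gdens \o z q) y))))//.
by apply: is_derive_eq; rewrite /GRing.scale/= /h3; ring.
Qed.

Let dh_q (q y : R) : 0 < q -> is_derive q 1 ((heat v) ^~ y) (h2 q y / 2).
Proof.
move=> q0.
by apply: (is_derive_eq (is_derive1_comp (g := z ^~ y)
  (is_derive_gcdf (z q y)) (dz_q y q0)));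
  rewrite /h2; field.
Qed.

Let dh2_q (q y : R) : 0 < q -> is_derive q 1 (fun q => h2 q y / 2) (k2 q y).
Proof.
move=> q0; have d0 := dz_q y q0; have d1 := dg_q y q0; have d2 := is_derive_isd q0.
rewrite (_ : (fun q => h2 q y / 2) =
  (fun q => - (isd q ^+ 2 * (z q y * (gdens \o (z ^~ y)) q)) / 2))//.
by apply: is_derive_eq; rewrite /GRing.scale/= /k2; field.
Qed.

Let zg_le (t : R) : `|t * gdens t| <= 3 / 2.
Proof.
rewrite normrM (ger0_norm (gdens_ge0 _)).
have g0 := @gdens_ge0 R t; have g1 := @gdens_le1 R t; have g2 := @gdens_mul2 R t.
have := sqr_ge0 (`|t| - 1); have := real_normK (num_real t).
have := normr_ge0 t; nra.
Qed.

Let h2_le p q y : 0 < p -> p <= q -> `|h2 q y| <= 2 * isd p ^+ 2.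
Proof.
move=> p0 pq; rewrite /h2 normrN normrM ger0_norm ?sqr_ge0//.
rewrite mulrC; apply: ler_pM; [by []|by rewrite exprn_ge0// isd_ge0| |].
  by rewrite (le_trans (zg_le _))//; lra.
by rewrite lerXn2r// ?nnegrE ?isd_ge0// isd_le.
Qed.

Let h3_le p q y : 0 < p -> p <= q -> `|h3 q y| <= 3 * isd p ^+ 3.
Proof.
move=> p0 pq; rewrite /h3 normrM ger0_norm ?exprn_ge0 ?isd_ge0//.
rewrite mulrC; apply: ler_pM; [by []|by rewrite exprn_ge0// isd_ge0| |];
    last first.
  by rewrite lerXn2r// ?nnegrE ?isd_ge0// isd_le.
set t := z q y.
have g0 := @gdens_ge0 R t; have g1 := @gdens_le1 R t; have g2 := @gdens_mul2 R t.
have := sqr_ge0 t; rewrite ler_norml => t2; apply/andP; split; nra.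
Qed.

Let k2_le p q y : 0 < p -> p <= q -> `|k2 q y| <= 4 * isd p ^+ 4.
Proof.
move=> p0 pq; rewrite /k2 -mulrA.
rewrite normrM ger0_norm ?exprn_ge0 ?isd_ge0//.
rewrite mulrC; apply: ler_pM; [by []|by rewrite exprn_ge0// isd_ge0| |];
    last first.
  by rewrite lerXn2r// ?nnegrE ?isd_ge0// isd_le.
set t := z q y; set g := gdens t.
have g0 := @gdens_ge0 R t; have g2 := @gdens_mul2 R t; have g4 := @gdens_mul4 R t.
have zg : `|t * g| <= 3 / 2 by exact: zg_le.
have zg3 : `|t ^+ 3 * g| <= 9.
  rewrite normrM (ger0_norm g0) normrX.
  have e2 := real_normK (num_real t).
  have : `|t| ^+ 3 <= (t ^+ 2 + t ^+ 4) / 2.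
    have -> : t ^+ 4 = (t ^+ 2) ^+ 2 by rewrite -exprM.
    rewrite -e2; have := sqr_ge0 (`|t| ^+ 2 - `|t|); have := normr_ge0 t; nra.
  move=> H; apply: le_trans (ler_wpM2r g0 H) _; nra.
move: zg zg3; rewrite !ler_norml => /andP[a1 a2] /andP[a3 a4].
have -> : 4^-1 * ((3 * t - t ^+ 3) * g) = 4^-1 * (3 * (t * g) - t ^+ 3 * g) by ring.
by apply/andP; split; lra.
Qed.

Let isT : is_interval (setT : set R). Proof. by []. Qed.

Let isP (p : R) : is_interval [set q : R | p <= q].
Proof. by move=> x y /= px py t /andP[xt _]; exact: le_trans px xt. Qed.

(** One step of the replacement of a Bernoulli walk by Brownian motion. The step
    [(1 - w) d] taken with probability [w], [- w d] otherwise, has mean [0] and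
    variance [w (1 - w) d^2]; by the heat equation, adding [w d^2] to the
    variance compensates it up to third order terms in [d] and second order
    terms in [w]. *)
Lemma heat_step (p q y w d : R) : 0 < p -> p <= q -> 0 <= w <= 1 -> 0 <= d ->
  `|(1 - w) * heat v q (y - w * d) + w * heat v q (y + (1 - w) * d)
    - heat v (q + w * d ^+ 2) y| <=
  w * d ^+ 2 * (6 * isd p ^+ 3 * d + isd p ^+ 2 * w + 4 * isd p ^+ 4 * (w * d ^+ 2)).
Proof.
move=> p0 pq /andP[w0 w1] d0.
have B0 := isd_gt0 p; set B := isd p in B0 *.
have A1 := taylor3_le isT (fun t _ => dh_y q t) (fun t _ => dh1_y q t)
  (fun t _ => dh2_y q t) (fun t _ => h3_le t p0 pq) (I : setT y) (I : setT (y - w * d)).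
have A2 := taylor3_le isT (fun t _ => dh_y q t) (fun t _ => dh1_y q t)
  (fun t _ => dh2_y q t) (fun t _ => h3_le t p0 pq) (I : setT y)
  (I : setT (y + (1 - w) * d)).
have wd0 : 0 <= w * d ^+ 2 by rewrite mulr_ge0// sqr_ge0.
have A3 := taylor2_le (isP (p := p)) (fun t pt => dh_q y (lt_le_trans p0 pt))
  (fun t pt => dh2_q y (lt_le_trans p0 pt)) (fun t pt => k2_le y p0 pt)
  (pq : [set q | p <= q] q) (ler_wpDr wd0 pq : [set q | p <= q] (q + w * d ^+ 2)).
have A4 := h2_le y p0 pq.
rewrite -/B in A1 A2 A3 A4.
move: A1 A2 A3 A4.
have -> : y - w * d - y = - (w * d) by ring.
have -> : y + (1 - w) * d - y = (1 - w) * d by ring.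
have -> : q + w * d ^+ 2 - q = w * d ^+ 2 by ring.
have w1' : 0 <= 1 - w by rewrite subr_ge0.
rewrite normrN (ger0_norm wd0) (ger0_norm (mulr_ge0 w0 d0)).
rewrite (ger0_norm (mulr_ge0 w1' d0)).
set f0 := heat v q y; set fm := heat v q _; set fp := heat v q _; set fq := heat v _ y.
set g1 := h1 q y; set g2 := h2 q y.
move=> A1 A2 A3 A4.
have -> : (1 - w) * fm + w * fp - fq =
   (1 - w) * (fm - f0 - - (w * d) * g1 - (- (w * d)) ^+ 2 / 2 * g2)
   + w * (fp - f0 - (1 - w) * d * g1 - ((1 - w) * d) ^+ 2 / 2 * g2)
   - (fq - f0 - w * d ^+ 2 * (g2 / 2))
   - w ^+ 2 * d ^+ 2 / 2 * g2 by field.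
rewrite (le_trans (ler_normB _ _))//.
rewrite (le_trans (lerD (ler_normB _ _) (lexx _)))//.
rewrite (le_trans (lerD (lerD (ler_normD _ _) (lexx _)) (lexx _)))//.
have B3 : 0 <= B ^+ 3 by rewrite exprn_ge0// ltW.
have d3 : 0 <= d ^+ 3 by rewrite exprn_ge0.
have C1 : `|(1 - w) * (fm - f0 - - (w * d) * g1 - (- (w * d)) ^+ 2 / 2 * g2)| <=
    3 * B ^+ 3 * (w * d ^+ 3).
  rewrite normrM (ger0_norm w1').
  apply: (@le_trans _ _ (1 * (3 * B ^+ 3 * (w * d) ^+ 3))).
    by apply: ler_pM => //; lra.
  have w3 : w ^+ 3 <= w by rewrite exprS ler_piMr// exprn_ile1.
  have := ler_wpM2r d3 w3; rewrite -exprMn => wd3.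
  by rewrite mul1r; apply: ler_wpM2l => //; rewrite mulr_ge0.
have C2 : `|w * (fp - f0 - (1 - w) * d * g1 - ((1 - w) * d) ^+ 2 / 2 * g2)| <=
    3 * B ^+ 3 * (w * d ^+ 3).
  rewrite normrM (ger0_norm w0).
  have w3 : (1 - w) ^+ 3 <= 1 by rewrite exprn_ile1//; lra.
  have := ler_wpM2r d3 w3; rewrite -exprMn mul1r => wd3.
  rewrite [leRHS]mulrCA; apply: ler_wpM2l => //; apply: (le_trans A2).
  by apply: ler_wpM2l => //; rewrite mulr_ge0.
have C4 : `|w ^+ 2 * d ^+ 2 / 2 * g2| <= w ^+ 2 * d ^+ 2 * B ^+ 2.
  have wd2 : 0 <= w ^+ 2 * d ^+ 2 by rewrite mulr_ge0 ?sqr_ge0.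
  rewrite -mulrA normrM (ger0_norm wd2); apply: ler_wpM2l => //.
  rewrite normrM gtr0_norm ?invr_gt0//; lra.
apply: (le_trans (lerD (lerD (lerD C1 C2) A3) C4)).
rewrite le_eqVlt; apply/orP; left; apply/eqP; ring.
Qed.

End derivatives.

End heat.

Section heat_regularity.
Context {R : realType}.

Lemma gcdf_lip (x y : R) : `|gcdf x - gcdf y| <= `|x - y|.
Proof.
rewrite -[leRHS]mul1r; apply: (@mvt_le R setT gcdf gdens 1 y x) => //.
by move=> t _; rewrite ger0_norm ?gdens_ge0// gdens_le1.
Qed.

Lemma heat_lip (v q x y : R) : `|heat v q x - heat v q y| <= isd q * `|x - y|.
Proof.
apply: le_trans (gcdf_lip _ _) _.
have -> : (v - x) * isd q - (v - y) * isd q = isd q * (y - x) by ring.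
by rewrite normrM distrC ger0_norm// isd_ge0.
Qed.

Lemma measurable_heat (v q : R) : measurable_fun setT (heat v q).
Proof.
apply: (measurableT_comp (f := @gcdf R)).
  by apply: nondecreasing_measurable => // x y; exact: gcdf_mono.
by apply: measurable_funM => //; exact: measurable_funB.
Qed.

End heat_regularity.

(** * Counting hits along a lacunary sequence *)

Section core.
Context {R : realType}.
Variables (a : nat -> R) (C : R).
Hypothesis a1 : 0 < a 1%N.
Hypothesis C1 : 1 < C.
Hypothesis lac : forall n : nat, (1 <= n)%N -> C * a n <= a n.+1.

Lemma lac_gt0 n : (1 <= n)%N -> 0 < a n.
Proof.
elim: n => // -[|n] IH _ //; apply: lt_le_trans (lac _) => //.
by rewrite mulr_gt0 ?IH// (lt_trans _ C1).
Qed.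

Lemma lac_pow n k : (1 <= n)%N -> C ^+ k * a n <= a (n + k)%N.
Proof.
move=> n1; elim: k => [|k IH]; first by rewrite addn0 expr0 mul1r.
rewrite addnS; apply: le_trans (lac _); last by rewrite addn_gt0 n1.
by rewrite exprS -mulrA ler_wpM2l// ltW// (lt_trans _ C1).
Qed.

Lemma lac_mono i j : (1 <= i)%N -> (i <= j)%N -> a i <= a j.
Proof.
move=> i1 ij; rewrite -(subnKC ij); apply: le_trans (lac_pow _ i1).
apply: ler_peMl; first exact/ltW/lac_gt0.
by rewrite exprn_ege1// ltW.
Qed.

Lemma lac_gap i j : (1 <= i)%N -> (i < j)%N -> (C - 1) * a 1%N <= a j - a i.
Proof.
move=> i1 ij; apply: (@le_trans _ _ ((C - 1) * a i)).
  by apply: ler_wpM2l; [rewrite subr_ge0 ltW|exact: lac_mono].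
by rewrite mulrBl mul1r lerD2r (le_trans (lac i1))// lac_mono.
Qed.

Variables (w : R).
Hypothesis w0 : 0 <= w.
Hypothesis w1 : 2 * w <= 1.

Let w01 : 0 <= w <= 1. Proof. by apply/andP; split; move: w0 w1; lra. Qed.

Definition hit_at (j : nat) (z : R * R) : R := hit w (z.1 * a j - z.2).

Definition hit_count (k : nat) (z : R * R) : R := \sum_(1 <= j < k.+1) hit_at j z.

Lemma hit_at_ge0 j z : 0 <= hit_at j z. Proof. exact: hit_ge0. Qed.
Lemma hit_at_le1 j z : hit_at j z <= 1. Proof. exact: hit_le1. Qed.

Lemma hit_at_01 j z : hit_at j z = 0 \/ hit_at j z = 1.
Proof.
by rewrite /hit_at /hit indicE; case: (_ \in _) => /=; [right|left].
Qed.

Lemma hit_at_bmeas j : bmeas (hit_at j).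
Proof.
apply: hit_bmeas; apply: measurable_funB => //.
by apply: measurable_funM.
Qed.

Lemma hit_count_bmeas k : bmeas (hit_count k).
Proof. by apply: bmeas_sum => j _ _; exact: hit_at_bmeas. Qed.

Lemma hit_countS k z : hit_count k.+1 z = hit_count k z + hit_at k.+1 z.
Proof. by rewrite /hit_count big_nat_recr. Qed.

Lemma hit_count_sub i k z : (i <= k)%N ->
  hit_count k z = hit_count i z + \sum_(i.+1 <= j < k.+1) hit_at j z.
Proof. by move=> ik; rewrite /hit_count (@big_cat_nat _ _ _ i.+1). Qed.

Lemma sum_hit_at_01 (r : seq nat) z :
  \sum_(j <- r) hit_at j z = 0 \/ 1 <= \sum_(j <- r) hit_at j z.
Proof.
elim: r => [|i r IH]; first by rewrite big_nil; left.
rewrite big_cons; have s0 : 0 <= \sum_(j <- r) hit_at j z.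
  by apply: sumr_ge0 => j _; exact: hit_at_ge0.
by have [->|->] := hit_at_01 i z; [rewrite add0r|right; rewrite lerDl].
Qed.

(* [U j] is evaluated at the number of hits among the first [j] points *)
Variable U : nat -> R -> R.
Hypothesis U_bounds : forall j s, 0 <= U j s <= 1.
Hypothesis mU : forall j, measurable_fun setT (U j).

Definition test_jump j s := U j (s + 1) - U j s.

Lemma test_jump_le1 j s : `|test_jump j s| <= 1.
Proof.
by rewrite /test_jump ler_norml; have := U_bounds j s; have := U_bounds j (s + 1);
  move=> /andP[? ?] /andP[? ?]; apply/andP; split; lra.
Qed.

Lemma bmeas_U j d (T : measurableType d) (f : T -> R) : bmeas f ->
  bmeas (fun z => U j (f z)).
Proof.
move=> [mf _]; split; first exact: measurableT_comp.
by exists 1 => z; rewrite ler_norml; have /andP[? ?] := U_bounds j (f z);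
  apply/andP; split; lra.
Qed.

Lemma bmeas_test_jump j d (T : measurableType d) (f : T -> R) : bmeas f ->
  bmeas (fun z => test_jump j (f z)).
Proof.
move=> bf; apply: bmeasB; last exact: bmeas_U.
by apply: bmeas_U; apply: bmeasD => //; exact: bmeas_cst.
Qed.

Variable D : nat.
Hypothesis D0 : (0 < D)%N.

(** The increment of [U] along the walk, with its coefficient frozen [D] steps
    earlier: [C ^ D] is large, so the point [j] moves much faster in [alpha] than
    everything in the coefficient. *)
Definition main_term j z := (hit_at j z - w) * test_jump j (hit_count (j - D) z).

(** The price of freezing the coefficient, paid only if some point close to [j]
    in index is a hit. *)
Definition cross_term j z := (hit_at j z + w) * (\sum_((j - D).+1 <= i < j) hit_at i z).

Lemma main_term_bmeas j : bmeas (main_term j).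
Proof.
apply: bmeasM; first by apply: bmeasB; [exact: hit_at_bmeas|exact: bmeas_cst].
exact/bmeas_test_jump/hit_count_bmeas.
Qed.

Lemma cross_term_bmeas j : bmeas (cross_term j).
Proof.
apply: bmeasM; first by apply: bmeasD; [exact: hit_at_bmeas|exact: bmeas_cst].
by apply: bmeas_sum => i _ _; exact: hit_at_bmeas.
Qed.

Variable e : R.
Variable N : nat.
Hypothesis U_step : forall j s, (j < N)%N ->
  `|(1 - w) * U j.+1 s + w * U j.+1 (s + 1) - U j s| <= e.

(** As hits are [0] or [1], the increment of [U] is exactly its conditional mean
    for a Bernoulli variable of parameter [w], which [U_step] controls, plus the
    centred hit times [test_jump]; freezing the coefficients adds the cross
    terms. *)
Lemma telescope_le n z : (n <= N)%N ->
  `|U n (hit_count n z) - U 0%N 0 - \sum_(1 <= j < n.+1) main_term j z| <=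
    n%:R * e + 2 * \sum_(1 <= j < n.+1) cross_term j z.
Proof.
elim: n => [_|n IH nN].
  rewrite /hit_count !big_geq//= subrr subr0 normr0 mul0r mulr0 addr0 //.
have {}IH := IH (ltnW nN).
rewrite [in X in `|X|]big_nat_recr//= [in leRHS]big_nat_recr//=.
set F := \sum_(1 <= j < n.+1) main_term j z in IH *.
set K := \sum_(1 <= j < n.+1) cross_term j z in IH *.
set s := hit_count n z in IH *.
have E : U n.+1 (hit_count n.+1 z) = (1 - w) * U n.+1 s + w * U n.+1 (s + 1)
    + (hit_at n.+1 z - w) * test_jump n.+1 s.
  rewrite hit_countS -/s /test_jump; have [->|->] := hit_at_01 n.+1 z; last by ring.
  by rewrite addr0; ring.
have A1 := U_step s nN.
have A2 : `|(hit_at n.+1 z - w) * test_jump n.+1 s - main_term n.+1 z| <=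
    2 * cross_term n.+1 z.
  rewrite /main_term -mulrBr normrM /cross_term mulrCA.
  apply: ler_pM => //.
    by apply: le_trans (ler_normB _ _) _; rewrite (ger0_norm w0) (ger0_norm (hit_at_ge0 _ _)).
  have le1 : (n.+1 - D <= n)%N by lia.
  rewrite /s (hit_count_sub z le1).
  have [->|h] := sum_hit_at_01 (index_iota (n.+1 - D).+1 n.+1) z.
    by rewrite addr0 subrr normr0 mulr0.
  rewrite (le_trans (ler_normB _ _))//.
  by rewrite (le_trans (lerD (test_jump_le1 _ _) (test_jump_le1 _ _)))//; lra.
rewrite E.
have -> : (1 - w) * U n.+1 s + w * U n.+1 (s + 1) + (hit_at n.+1 z - w) * test_jump n.+1 s
    - U 0 0 - (F + main_term n.+1 z) =
  (U n s - U 0 0 - F) + ((1 - w) * U n.+1 s + w * U n.+1 (s + 1) - U n s)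
  + ((hit_at n.+1 z - w) * test_jump n.+1 s - main_term n.+1 z) by ring.
rewrite (le_trans (ler_normD _ _))//.
rewrite (le_trans (lerD (ler_normD _ _) A2))//.
rewrite (le_trans (lerD (lerD IH A1) (lexx _)))//.
by rewrite -natr1 le_eqVlt; apply/orP; left; apply/eqP; ring.
Qed.

Variable A : R.
Hypothesis A0 : 0 < A.

Let mX := @leb_itv R 0 1.
Let mA := @leb_itv R (- A) A.

Let mX1 : fine (mX setT) = 1. Proof. by rewrite leb_itvT// subr0. Qed.

Let NAA : - A <= A. Proof. by move: A0; lra. Qed.

Let mA2 : fine (mA setT) = 2 * A. Proof. by rewrite leb_itvT//; ring. Qed.

Definition main_mean j (al : R) := \int[mX]_x main_term j (al, x).
Definition main_sum (al : R) := \sum_(1 <= j < N.+1) main_mean j al.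
Definition cross_sum (al : R) :=
  2 * \sum_(1 <= j < N.+1) \int[mX]_x cross_term j (al, x).

Lemma main_sum_bmeas : bmeas main_sum.
Proof. by apply: bmeas_sum => j _ _; apply: (bmeas_int2 mA mX); exact: main_term_bmeas. Qed.

Lemma cross_sum_bmeas : bmeas cross_sum.
Proof.
apply: bmeasM; first exact: bmeas_cst.
by apply: bmeas_sum => j _ _; apply: (bmeas_int2 mA mX); exact: cross_term_bmeas.
Qed.

Lemma cross_term_ge0 j z : 0 <= cross_term j z.
Proof.
rewrite mulr_ge0// ?addr_ge0 ?hit_at_ge0//.
by apply: sumr_ge0 => i _; exact: hit_at_ge0.
Qed.

Lemma cross_sum_ge0 al : 0 <= cross_sum al.
Proof.
rewrite mulr_ge0//; apply: sumr_ge0 => j _; apply: Rintegral_ge0 => x _.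
exact: cross_term_ge0.
Qed.

Lemma quenched_le al :
  `|\int[mX]_x U N (hit_count N (al, x)) - U 0%N 0| <=
    N%:R * e + `|main_sum al| + cross_sum al.
Proof.
have bU : bmeas (fun x => U N (hit_count N (al, x))).
  by apply: bmeas_U; exact: bmeas_sec1 (hit_count_bmeas N).
have bf j : bmeas (fun x => main_term j (al, x)) by exact: bmeas_sec1 (main_term_bmeas j).
have bc j : bmeas (fun x => cross_term j (al, x)) by exact: bmeas_sec1 (cross_term_bmeas j).
have bF : bmeas (fun x => \sum_(1 <= j < N.+1) main_term j (al, x)).
  by apply: bmeas_sum.
have bC : bmeas (fun x => \sum_(1 <= j < N.+1) cross_term j (al, x)).
  by apply: bmeas_sum.
have H := bint_abs mX (bmeasB (bmeasB bU (bmeas_cst (U 0%N 0))) bF).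
have : \int[mX]_x `|U N (hit_count N (al, x)) - U 0%N 0 - \sum_(1 <= j < N.+1) main_term j (al, x)|
   <= \int[mX]_x (N%:R * e + 2 * \sum_(1 <= j < N.+1) cross_term j (al, x)).
  apply: bint_le.
  - apply: bmeas_norm; apply: bmeasB => //; apply: bmeasB => //; exact: bmeas_cst.
  - by apply: bmeasD; [exact: bmeas_cst|apply: bmeasM => //; exact: bmeas_cst].
  - by move=> x; exact: telescope_le.
move=> /(le_trans H).
have -> : \int[mX]_x (N%:R * e + 2 * \sum_(1 <= j < N.+1) cross_term j (al, x)) =
    N%:R * e + cross_sum al.
  rewrite bintD; [|exact: bmeas_cst|by apply: bmeasM => //; exact: bmeas_cst].
  by rewrite bint_cst mX1 mulr1 bintZ// bint_sum.
rewrite bintB//; last by apply: bmeasB => //; exact: bmeas_cst.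
rewrite bintB//; last exact: bmeas_cst.
rewrite bint_cst mX1 mulr1 bint_sum// -/(main_sum al) => H1.
set I := \int[mX]_x _ in H1 *.
have -> : I - U 0 0 = (I - U 0 0 - main_sum al) + main_sum al by ring.
by rewrite (le_trans (ler_normD _ _))//; move: H1; lra.
Qed.

Let mXh j al : \int[mX]_x hit_at j (al, x) <= 3 * w.
Proof. exact: (@int_hit_unit R w (al * a j) w01). Qed.

Let bh j al : bmeas (fun x => hit_at j (al, x)).
Proof. exact: bmeas_sec1 (hit_at_bmeas j). Qed.

(** This is true for every [al]: for fixed [al], integrating over [x] makes a
    single hit an event of probability of the order of [w]. *)
Lemma main_mean_le j al : `|main_mean j al| <= 4 * w.
Proof.
have bf : bmeas (fun x => main_term j (al, x)) by exact: bmeas_sec1 (main_term_bmeas j).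
apply: le_trans (bint_abs mX bf) _.
apply: (@le_trans _ _ (\int[mX]_x (hit_at j (al, x) + w))).
  apply: bint_le; [exact: bmeas_norm|by apply: bmeasD => //; exact: bmeas_cst|].
  move=> x; rewrite /main_term normrM -[leRHS]mulr1; apply: ler_pM => //; last exact: test_jump_le1.
  by rewrite (le_trans (ler_normB _ _))// (ger0_norm w0) ger0_norm// hit_at_ge0.
rewrite bintD//; last exact: bmeas_cst.
by rewrite bint_cst mX1 mulr1; have := mXh j al; lra.
Qed.

Lemma jumps_hit_count k x : jumps (- A) A
  (\sum_(1 <= i < k.+1) 2 * (a i * (A - - A) + 2)) (fun al => hit_count k (al, x)).
Proof.
apply: jumps_sum => i; rewrite mem_index_iota => /andP[i1 _].
exact: (jumps_hit (- x) (lac_gt0 i1) w01 NAA).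
Qed.

Let q j := 2 * (a j * (A - - A) + 2).

Let q_le i j : (1 <= i)%N -> (i <= j)%N -> q i <= q j.
Proof.
move=> i1 ij; rewrite /q ler_wpM2l// lerD2r ler_wpM2r//; last exact: lac_mono.
by move: A0; lra.
Qed.

Let q_sum k j : (k <= j)%N -> (1 <= j)%N -> \sum_(1 <= i < k.+1) q i <= k%:R * q j.
Proof.
move=> kj j1; apply: (@le_trans _ _ (\sum_(1 <= i < k.+1) q j)).
  rewrite big_seq [leRHS]big_seq; apply: ler_sum => i.
  rewrite mem_index_iota => /andP[i1 ik]; apply: q_le => //.
  by rewrite (leq_trans _ kj).
by rewrite sumr_const_nat subn1 mulr_natl.
Qed.

(** The product is the centred hit [j], oscillating with frequency [a j], times a
    step function of [al] with at most a constant times [N * a (j - D)] jumps,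
    because it depends on the points up to [j - D] only. *)
Lemma far_le i j : (0 < i)%N -> (i + D <= j)%N -> (j <= N)%N -> forall x x',
  `|\int[mA]_al (main_term j (al, x) * main_term i (al, x'))| <=
    3 * N%:R * (8 * A + 10 / a 1%N) / C ^+ D.
Proof.
move=> i0 iDj jN x x'.
pose psi al := test_jump j (hit_count (j - D) (al, x)) * main_term i (al, x').
have bpsi : bmeas psi.
  apply: bmeasM; first by apply: bmeas_test_jump; exact: bmeas_sec2 (hit_count_bmeas _).
  exact: bmeas_sec2 (main_term_bmeas i).
have bg : bmeas (fun al => hit_at j (al, x) - w).
  by apply: bmeasB; [exact: bmeas_sec2 (hit_at_bmeas j)|exact: bmeas_cst].
have j0 : (0 < j)%N by lia.
have jD0 : (0 < j - D)%N by lia.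
have ijD : (i <= j - D)%N by lia.
have iDjD : (i - D <= j - D)%N by lia.
have jDN : (j - D <= N)%N by lia.
have Dj : (D <= j)%N by lia.
under eq_Rintegral do rewrite /main_term -mulrA -/(main_term i _) -/(psi _).
pose J := (\sum_(1 <= k < (j - D).+1) q k) + (q i + \sum_(1 <= k < (i - D).+1) q k).
have jp : jumps (- A) A J psi.
  apply: (jumps_op (fun u v => u * v)).
    exact/jumps_comp/jumps_hit_count.
  apply: (jumps_op (fun u v => u * v)).
    apply: (jumps_comp (fun u => u - w)).
    exact: (jumps_hit (- x') (lac_gt0 i0) w01 NAA).
  exact/jumps_comp/jumps_hit_count.
have psi1 y : `|psi y| <= 1.
  rewrite /psi /main_term normrM -[leRHS]mulr1; apply: ler_pM => //; first exact: test_jump_le1.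
  rewrite normrM -[leRHS]mulr1; apply: ler_pM => //; last exact: test_jump_le1.
  have := hit_at_ge0 i (y, x'); have := hit_at_le1 i (y, x').
  by rewrite ler_norml => ? ?; apply/andP; split; move: w0 w1; lra.
have B p r : - A <= p -> p <= r -> r <= A ->
    `|\int[leb_itv p r]_al (hit_at j (al, x) - w)| <= 2 / a j.
  move=> _ pr _; exact: (int_hit_dev (- x) (lac_gt0 j0) w01 pr).
apply: le_trans (int_mul_jumps NAA bpsi bg psi1 jp B) _.
set t := a (j - D)%N; have t0 : 0 < t by exact: lac_gt0.
have c0 : 0 < C ^+ D by rewrite exprn_gt0// (lt_trans _ C1).
have tj : C ^+ D * t <= a j.
  by have := lac_pow D jD0; rewrite subnK.
have t1 : a 1%N <= t by exact: lac_mono.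
have aj0 := lac_gt0 j0.
have N1 : 1 <= N%:R :> R by rewrite ler1n (leq_trans j0).
have JN : J + 1 <= 3 * N%:R * (q (j - D)%N + 1).
  have q0 : 0 <= q (j - D)%N.
    by rewrite /q -/t; move: A0 t0; nra.
  have s1 := q_sum (leqnn (j - D)) jD0.
  have s2 : q i <= q (j - D)%N by apply: q_le.
  have s3 : \sum_(1 <= k < (i - D).+1) q k <= (i - D)%:R * q (j - D)%N.
    exact: q_sum.
  have n1 : (j - D)%:R <= N%:R :> R by rewrite ler_nat.
  have n2 : (i - D)%:R <= N%:R :> R by rewrite ler_nat (leq_trans iDjD).
  have m1 := ler_wpM2r q0 n1; have m2 := ler_wpM2r q0 n2; have m3 := ler_wpM2r q0 N1.
  by rewrite /J; move: m1 m2 m3 s1 s2 s3 N1; rewrite mul1r; lra.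
apply: (@le_trans _ _ (3 * N%:R * (q (j - D)%N + 1) * (2 / a j))).
  by rewrite ler_wpM2r// divr_ge0// ltW.
rewrite -!mulrA; apply: ler_wpM2l => //; apply: ler_wpM2l => //.
rewrite mulrA ler_pdivrMr// -mulrA [X in _ <= _ * X]mulrC.
rewrite /q -/t opprK.
have ajt : t <= a j / C ^+ D by rewrite ler_pdivlMr// mulrC.
have k1 : 1 <= a j / C ^+ D / a 1%N.
  by rewrite ler_pdivlMr// mul1r (le_trans t1).
set y := a j / C ^+ D in ajt k1 *.
have -> : (2 * (t * (A + A) + 2) + 1) * 2 = 8 * A * t + 10 by ring.
rewrite [leRHS]mulrDl; apply: lerD.
  by rewrite ler_wpM2l// mulr_ge0// ltW.
by rewrite mulrAC -mulrA ler_peMr// mulrC.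
Qed.

Lemma main_sum_second_moment :
  \int[mA]_al (main_sum al) ^+ 2 <= 64 * A * (D%:R * N%:R * w ^+ 2)
    + 3 * (8 * A + 10 / a 1%N) * (N%:R ^+ 3 / C ^+ D).
Proof.
have e0 : 0 <= 3 * N%:R * (8 * A + 10 / a 1%N) / C ^+ D.
  rewrite divr_ge0//; last by rewrite exprn_ge0// ltW// (lt_trans _ C1).
  by rewrite mulr_ge0// addr_ge0// ?divr_ge0 ?mulr_ge0// ltW.
have := second_moment (mA := mA) (mX := mX) e0 main_term_bmeas main_mean_le far_le.
rewrite mX1 mA2 => /le_trans; apply.
by rewrite natrM le_eqVlt; apply/orP; left; apply/eqP; ring.
Qed.

(** For neighbouring indices and fixed [x] the hits may be strongly correlated.
    Averaging over [x] leaves the event that [al (a j - a i)] is within [w] of an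
    integer, and [a j - a i] is bounded below. *)
Lemma pair_le i j : (1 <= i)%N -> (i < j)%N ->
  \int[mA]_al \int[mX]_x (hit_at j (al, x) * hit_at i (al, x)) <=
    12 * (A + ((C - 1) * a 1%N)^-1) * w ^+ 2.
Proof.
move=> i1 ij; pose b := a j - a i.
have g0 : 0 < (C - 1) * a 1%N by rewrite mulr_gt0// subr_gt0.
have gb : (C - 1) * a 1%N <= b by exact: lac_gap.
have b0 : 0 < b by exact: lt_le_trans gb.
have bH : bmeas (fun al : R => hit (2 * w) (al * b + 0)).
  by apply: hit_bmeas; exact: measurable_affine.
have b3 : bmeas (fun al : R => 3 * w * hit (2 * w) (al * b + 0)).
  by apply: bmeasM => //; exact: bmeas_cst.
apply: (@le_trans _ _ (\int[mA]_al (3 * w * hit (2 * w) (al * b + 0)))).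
  apply: bint_le => //.
    apply: (bmeas_int2 mA mX (f := fun z => hit_at j z * hit_at i z)).
    by apply: bmeasM; exact: hit_at_bmeas.
  move=> al; apply: (@le_trans _ _
      (\int[mX]_x (hit_at i (al, x) * hit (2 * w) (al * b + 0)))).
    apply: bint_le.
    - by apply: bmeasM; exact: bh.
    - by apply: bmeasM; [exact: bh|exact: bmeas_cst].
    - move=> x; rewrite mulrC (le_trans (hit_mul_le _ _ _))//=.
      rewrite le_eqVlt; apply/orP; left; apply/eqP; congr (_ * hit _ _).
      by rewrite /b; ring.
  by rewrite bintZr// ler_wpM2r// hit_ge0.
rewrite bintZ//.
have w21 : 0 <= 2 * w <= 1 by rewrite w1 mulr_ge0.
have H := int_hit_le 0 b0 w21 NAA.
apply: le_trans (ler_wpM2l (mulr_ge0 (ler0n _ _) w0) H) _.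
have ib : b^-1 <= ((C - 1) * a 1%N)^-1 by rewrite lef_pV2.
set g := _^-1 in ib *; set c := b^-1 in ib *.
have -> : 3 * w * (2 * w * (A - - A) + 2 * (2 * w) * c) =
   12 * (A + c) * w ^+ 2 by ring.
by rewrite ler_wpM2r ?sqr_ge0// ler_wpM2l// lerD2l.
Qed.

Lemma cross_sum_mean :
  \int[mA]_al cross_sum al <=
    2 * (18 * A + 12 * ((C - 1) * a 1%N)^-1) * (D%:R * N%:R * w ^+ 2).
Proof.
set G := ((C - 1) * a 1%N)^-1.
have G0 : 0 <= G by rewrite invr_ge0 mulr_ge0 ?subr_ge0// ltW.
have bc j : bmeas (fun al => \int[mX]_x cross_term j (al, x)).
  by apply: (bmeas_int2 mA mX); exact: cross_term_bmeas.
rewrite bintZ; last by apply: bmeas_sum.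
rewrite bint_sum// -mulrA ler_wpM2l//.
have cjE j : \int[mA]_al \int[mX]_x cross_term j (al, x) <=
    (D%:R) * ((18 * A + 12 * G) * w ^+ 2).
  have jD : (j - (j - D).+1 <= D)%N by lia.
  pose r := index_iota (j - D).+1 j.
  have bhh i : bmeas (fun z => hit_at j z * hit_at i z) by apply: bmeasM; exact: hit_at_bmeas.
  have bwh i : bmeas (fun z => w * hit_at i z).
    by apply: bmeasM; [exact: bmeas_cst|exact: hit_at_bmeas].
  have -> : \int[mA]_al \int[mX]_x cross_term j (al, x) =
    \sum_(i <- r) (\int[mA]_al \int[mX]_x (hit_at j (al, x) * hit_at i (al, x))
        + \int[mA]_al \int[mX]_x (w * hit_at i (al, x))).
    transitivity (\int[mA]_al \sum_(i <- r) (\int[mX]_x (hit_at j (al, x) * hit_at i (al, x))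
        + \int[mX]_x (w * hit_at i (al, x)))).
      apply: eq_Rintegral => al _.
      transitivity (\int[mX]_x (\sum_(i <- r)
         (hit_at j (al, x) * hit_at i (al, x) + w * hit_at i (al, x)))).
        apply: eq_Rintegral => x _; rewrite /cross_term mulr_sumr.
        by apply: eq_bigr => i _; rewrite mulrDl.
      rewrite bint_sum; last first.
        by move=> i _ _; apply: bmeasD; [exact: bmeas_sec1 (bhh i)|exact: bmeas_sec1 (bwh i)].
      apply: eq_bigr => i _; rewrite bintD//; first exact: bmeas_sec1 (bhh i).
      exact: bmeas_sec1 (bwh i).
    have b1 i := bmeas_int2 mA mX (bhh i); have b2 i := bmeas_int2 mA mX (bwh i).
    rewrite bint_sum; last by move=> i _ _; exact: bmeasD (b1 i) (b2 i).
    by apply: eq_bigr => i _; rewrite (bintD _ (b1 i) (b2 i)).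
  apply: (@le_trans _ _ (\sum_(i <- r) ((18 * A + 12 * G) * w ^+ 2))).
    rewrite big_seq [leRHS]big_seq; apply: ler_sum => i.
    rewrite mem_index_iota => /andP[i1 ij].
    have i0 : (1 <= i)%N by lia.
    have -> : (18 * A + 12 * G) * w ^+ 2 =
       12 * (A + G) * w ^+ 2 + 3 * w ^+ 2 * (2 * A) by ring.
    apply: lerD; first exact: pair_le.
    rewrite -mA2 -bint_cst; apply: bint_le.
    - exact: (bmeas_int2 mA mX (bwh i)).
    - exact: bmeas_cst.
    - move=> al; rewrite bintZ//.
      by apply: le_trans (ler_wpM2l w0 (mXh i al)) _; rewrite mulrCA -expr2.
  rewrite sumr_const_nat -[leLHS]mulr_natl; apply: ler_wpM2r; last by rewrite ler_nat.
  by rewrite mulr_ge0 ?sqr_ge0// addr_ge0// mulr_ge0// ltW.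
apply: (@le_trans _ _ (\sum_(1 <= j < N.+1) (D%:R * ((18 * A + 12 * G) * w ^+ 2)))).
  by apply: ler_sum => j _; exact: cjE.
rewrite sumr_const_nat subn1 -[leLHS]mulr_natl/=.
by rewrite le_eqVlt; apply/orP; left; apply/eqP; ring.
Qed.

End core.

(** * Almost sure convergence along a sparse grid *)

Section ae_cvg.
Context {d : measure_display} {T : measurableType d} {R : realType}.
Variable mu : {finite_measure set T -> \bar R}.

(** A nonnegative series whose integrals sum up is summable almost everywhere. *)
Lemma ae_cvg0 (Q : nat -> T -> R) (K : R) : (forall m, bmeas (Q m)) ->
  (forall m x, 0 <= Q m x) ->
  (forall n, \sum_(0 <= m < n) \int[mu]_x Q m x <= K) ->
  {ae mu, forall x, Q m x @[m --> \oo] --> (0 : R)}.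
Proof.
move=> bQ Q0 QK.
pose f m := EFin \o Q m.
have mf m : measurable_fun setT (f m) by apply/measurable_EFinP; case: (bQ m).
have f0 m x : setT x -> (0 <= f m x)%E by move=> _; rewrite lee_fin.
have If : mu.-integrable setT (fun x => \sum_(0 <= m <oo) f m x)%E.
  apply/integrableP; split.
    by apply: ge0_emeasurable_sum => // m x _ _; exact: f0.
  rewrite (@le_lt_trans _ _ K%:E)// ?ltry//.
  under eq_integral => x _.
    rewrite gee0_abs; last by apply: nneseries_ge0 => m _ _; exact: f0.
    over.
  rewrite integral_nneseries//.
  apply: lime_le; first by apply: is_cvg_ereal_nneg_natsum => m _;
    apply: integral_ge0 => x _; exact: f0.
  apply: nearW => n; under eq_bigr do rewrite EFin_bint//.
  by rewrite sumEFin lee_fin.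
have := integrable_ae measurableT If.
apply: filterS => x /(_ Logic.I) fx.
have bnd n : \sum_(0 <= m < n) Q m x <= fine (\sum_(0 <= m <oo) f m x)%E.
  rewrite -lee_fin fineK// -sumEFin; apply: nneseries_lim_ge => m _ _.
  exact: f0.
apply: cvg_series_cvg_0; apply: nondecreasing_is_cvgn.
  by apply: nondecreasing_series => m _ _; exact: Q0.
by exists (fine (\sum_(0 <= m <oo) f m x)%E) => _ [n _ <-]; exact: bnd.
Qed.

End ae_cvg.

Section growth.
Context {R : realType}.

(** Bernoulli's inequality for the [k]-th root of [C]. *)
Lemma exprn_dominates (k : nat) (C : R) : 1 < C ->
  exists2 c, 0 < c & forall m : nat, m%:R ^+ k <= c * C ^+ m.
Proof.
move=> C1; have C0 : 0 < C by exact: lt_trans C1.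
case: k => [|k].
  by exists 1 => // m; rewrite expr0 mul1r exprn_ege1// ltW.
pose b := expR (ln C / k.+1%:R).
have b1 : 1 < b by rewrite expR_gt1 divr_gt0// ln_gt0.
have bk : b ^+ k.+1 = C.
  by rewrite /b -expRM_natr mulrVK ?unitfE// lnK.
have bern m : m%:R * (b - 1) <= b ^+ m.
  elim: m => [|m IH]; first by rewrite mul0r expr0.
  rewrite exprS -natr1 mulrDl mul1r.
  have bm : 1 <= b ^+ m by rewrite exprn_ege1// ltW.
  have h : 0 <= (b - 1) * (b ^+ m - 1) by rewrite mulr_ge0// subr_ge0// ltW.
  have -> : b * b ^+ m = b ^+ m + (b - 1) + (b - 1) * (b ^+ m - 1) by ring.
  by lra.
exists (((b - 1) ^+ k.+1)^-1) => [|m].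
  by rewrite invr_gt0 exprn_gt0// subr_gt0.
rewrite mulrC ler_pdivlMr ?exprn_gt0 ?subr_gt0//.
rewrite -exprMn -bk -exprM mulnC exprM lerXn2r ?nnegrE//.
  by rewrite mulr_ge0// subr_ge0 ltW.
by rewrite exprn_ge0// ltW// (lt_trans _ b1).
Qed.

Lemma sum_inv_sqr (n : nat) : \sum_(0 <= m < n) ((m.+1%:R) ^+ 2)^-1 <= 2 :> R.
Proof.
suff H : \sum_(0 <= m < n.+1) ((m.+1%:R) ^+ 2)^-1 <= 2 - n.+1%:R^-1 :> R.
  case: n H => [|n] H; first by rewrite big_geq.
  apply: (@le_trans _ _ (2 - n.+2%:R^-1)); last by rewrite gerBl invr_ge0.
  by apply: le_trans H; rewrite [leRHS]big_nat_recr//= lerDl invr_ge0 sqr_ge0.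
elim: n => [|n IH]; first by rewrite big_nat1 expr1n invr1; lra.
rewrite big_nat_recr//= (le_trans (lerD IH (lexx _)))//.
have h1 : 0 < n.+1%:R :> R by rewrite ltr0n.
rewrite -[n.+2%:R]natr1; set t := n.+1%:R in h1 *.
rewrite -lerBrDl -subr_ge0.
have -> : 2 - (t + 1)^-1 - (2 - t^-1) - ((t + 1) ^+ 2)^-1 = (t * (t + 1) ^+ 2)^-1.
  by field; rewrite !gt_eqF//; lra.
by rewrite invr_ge0 mulr_ge0 ?sqr_ge0// ltW.
Qed.

End growth.

Section grid.
Context {R : realType}.
Variables (a : nat -> R) (C : R).
Hypothesis a1 : 0 < a 1%N.
Hypothesis C1 : 1 < C.
Hypothesis lac : forall n : nat, (1 <= n)%N -> C * a n <= a n.+1.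
Variables (v p : R).
Hypothesis p0 : 0 < p.

(** The heat flow run backwards in time: after [j] of [N] steps of mean [l / N],
    the variance still to be gained is [1 - j / N]. *)
Definition test_fun (N : nat) (l : R) (j : nat) (s : R) : R :=
  heat v (p + (1 - j%:R / N%:R)) ((s - j%:R * (l / N%:R)) / Num.sqrt l).

Lemma test_fun_bounds N l j s : 0 <= test_fun N l j s <= 1.
Proof. by rewrite heat_ge0 heat_le1. Qed.

Lemma measurable_test_fun N l j : measurable_fun setT (test_fun N l j).
Proof.
apply: (measurableT_comp (@measurable_heat R _ _)).
by apply: measurable_funM => //; exact: measurable_funB.
Qed.

Definition step_err (N : nat) (l : R) : R :=
  N%:R^-1 * (6 * isd p ^+ 3 / Num.sqrt l + isd p ^+ 2 * (l / N%:R)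
    + 4 * isd p ^+ 4 / N%:R).

Lemma test_fun_step N l j s : 0 < l -> l <= N%:R -> (j < N)%N ->
  `|(1 - l / N%:R) * test_fun N l j.+1 s + l / N%:R * test_fun N l j.+1 (s + 1)
    - test_fun N l j s| <= step_err N l.
Proof.
move=> l0 lN jN.
have N0 : 0 < N%:R :> R by exact: lt_le_trans lN.
have sl0 : 0 < Num.sqrt l by rewrite sqrtr_gt0.
have sl2 : Num.sqrt l ^+ 2 = l by rewrite sqr_sqrtr// ltW.
pose dd := (Num.sqrt l)^-1; pose w := l / N%:R; pose q := p + (1 - j.+1%:R / N%:R).
have wd : w * dd ^+ 2 = N%:R^-1.
  by rewrite /w /dd exprVn sl2; field; rewrite !gt_eqF.
have pq : p <= q.
  by rewrite /q lerDl subr_ge0 ler_pdivrMr// mul1r ler_nat.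
have w01 : 0 <= w <= 1.
  by rewrite /w ler_pdivrMr// mul1r lN andbT divr_ge0// ltW.
have d0 : 0 <= dd by rewrite invr_ge0 ltW.
have := heat_step v ((s - j%:R * w) * dd) p0 pq w01 d0.
rewrite wd /step_err -/w -/dd /test_fun -/w -/dd -/q.
have -> : (s - j%:R * w) * dd - w * dd = (s - j.+1%:R * w) * dd.
  by rewrite -natr1; ring.
have -> : (s - j%:R * w) * dd + (1 - w) * dd = (s + 1 - j.+1%:R * w) * dd.
  by rewrite -natr1; ring.
have -> : q + N%:R^-1 = p + (1 - j%:R / N%:R).
  by rewrite /q -natr1; field; rewrite gt_eqF.
by [].
Qed.

Let N m := (m ^ 7)%N.
(** The exponent [7] is what makes the second moments, of order
    [D N w^2 <= m * m^7 * (m / m^7)^2 = m^-4] for gaps [D = m], summable over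
    the [m ^ 2] windows and over [m]; the spacing [1 / m] of the windows is fine
    enough to round any window. *)
Definition grid_len (m i : nat) : R := i%:R / m%:R.
Definition grid_width (m i : nat) : R := grid_len m i / (m ^ 7)%:R.

Definition grid_err m i (al : R) : R :=
  main_sum a (grid_width m i) (test_fun (N m) (grid_len m i)) m (N m) al ^+ 2
  + cross_sum a (grid_width m i) m (N m) al.

Definition grid_total m al := \sum_(1 <= i < (m ^ 2).+1) grid_err m i al.

Lemma grid_width_ge0 m i : 0 <= grid_width m i.
Proof. by rewrite !mulr_ge0// invr_ge0. Qed.

Lemma grid_width_le m i : (2 <= m)%N -> (i <= m ^ 2)%N -> 2 * grid_width m i <= 1.
Proof.
move=> m2 im; rewrite /grid_width /grid_len.
have m0 : 0 < m%:R :> R by rewrite ltr0n; lia.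
rewrite mulrA ler_pdivrMr ?ltr0n ?expn_gt0//; last by lia.
rewrite mulrA ler_pdivrMr// mul1r -!natrM ler_nat -expnSr.
apply: (@leq_trans (m * m ^ 2)); first by rewrite leq_mul.
by rewrite -expnS leq_pexp2l//; lia.
Qed.

Lemma grid_err_ge0 m i al : 0 <= grid_err m i al.
Proof. by rewrite addr_ge0 ?sqr_ge0// cross_sum_ge0// grid_width_ge0. Qed.

Lemma grid_err_bmeas m i : bmeas (grid_err m i).
Proof.
have bM := main_sum_bmeas a (grid_width m i) (test_fun_bounds (N m) (grid_len m i))
  (measurable_test_fun (N m) (grid_len m i)) m (N m) 1.
apply: bmeasD; last exact: cross_sum_bmeas 1.
exact: bmeasM.
Qed.

Variable A : R.
Hypothesis A0 : 0 < A.

Lemma grid_err_mean : exists2 K, 0 < K & forall m i, (2 <= m)%N -> (i <= m ^ 2)%N ->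
  \int[leb_itv (- A) A]_al grid_err m i al <= K / (m%:R ^+ 4).
Proof.
have [c c0 Hc] := exprn_dominates 25 C1.
pose K1 := 64 * A + 2 * (18 * A + 12 / ((C - 1) * a 1%N)).
pose K2 := 3 * (8 * A + 10 / a 1%N).
have K10 : 0 < K1.
  by rewrite !addr_gt0// ?mulr_gt0// addr_gt0// ?divr_gt0 ?mulr_gt0// subr_gt0.
have K20 : 0 < K2 by rewrite mulr_gt0// addr_gt0 ?divr_gt0 ?mulr_gt0.
exists (K1 + K2 * c); first by rewrite addr_gt0// mulr_gt0.
move=> m i m2 im.
have m0 : (0 < m)%N by lia.
have m0R : 0 < m%:R :> R by rewrite ltr0n.
have w2 := grid_width_le m2 im; have w0 := grid_width_ge0 m i.
have bM : bmeas (main_sum a (grid_width m i) (test_fun (N m) (grid_len m i)) m (N m)).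
  exact: main_sum_bmeas (test_fun_bounds _ _) (measurable_test_fun _ _) _ _ 1.
have bR : bmeas (cross_sum a (grid_width m i) m (N m)) by exact: cross_sum_bmeas 1.
rewrite bintD//; last exact: bmeasM.
have H1 := main_sum_second_moment a1 C1 lac w0 w2 (test_fun_bounds (N m) (grid_len m i))
  (measurable_test_fun (N m) (grid_len m i)) m0 (N m) A0.
have H2 := cross_sum_mean a1 C1 lac w0 w2 m0 (N m) A0.
apply: le_trans (lerD H1 H2) _.
have E1 : m%:R * (N m)%:R * grid_width m i ^+ 2 <= (m%:R ^+ 4)^-1.
  rewrite /grid_width /grid_len /N natrX.
  have iR : i%:R <= m%:R ^+ 2 :> R by rewrite -natrX ler_nat.
  have -> : m%:R * m%:R ^+ 7 * (i%:R / m%:R / m%:R ^+ 7) ^+ 2 =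
     i%:R ^+ 2 / m%:R ^+ 8 :> R by field; rewrite gt_eqF.
  have -> : (m%:R ^+ 4)^-1 = (m%:R ^+ 2) ^+ 2 / m%:R ^+ 8 :> R.
    by field; rewrite gt_eqF.
  by rewrite ler_wpM2r ?invr_ge0 ?exprn_ge0// lerXn2r ?nnegrE// exprn_ge0.
have E2 : (N m)%:R ^+ 3 / C ^+ m <= c / m%:R ^+ 4.
  rewrite ler_pdivrMr ?exprn_gt0// ?(lt_trans _ C1)//.
  rewrite mulrAC ler_pdivlMr ?exprn_gt0// /N natrX -exprM -exprD.
  exact: Hc.
set x := m%:R * (N m)%:R * grid_width m i ^+ 2 in E1 *.
have -> : 64 * A * x + 3 * (8 * A + 10 / a 1) * ((N m)%:R ^+ 3 / C ^+ m) +
    2 * (18 * A + 12 / ((C - 1) * a 1)) * x = K1 * x + K2 * ((N m)%:R ^+ 3 / C ^+ m).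
  by rewrite /K1 /K2; ring.
rewrite [leRHS]mulrDl -[X in _ <= _ + X]mulrA.
by apply: lerD; apply: ler_wpM2l => //; exact: ltW.
Qed.

Lemma grid_total_ae :
  {ae leb_itv (- A) A, forall al, grid_total m.+2 al @[m --> \oo] --> (0 : R)}.
Proof.
have [K K0 HK] := grid_err_mean.
apply: (ae_cvg0 (K := K * 2)).
- by move=> m; apply: bmeas_sum => i _ _; exact: grid_err_bmeas.
- by move=> m al; apply: sumr_ge0 => i _; exact: grid_err_ge0.
move=> n; apply: le_trans (ler_wpM2l (ltW K0) (sum_inv_sqr n)).
rewrite mulr_sumr; apply: ler_sum => m _.
rewrite bint_sum; last by move=> i _ _; exact: grid_err_bmeas.
apply: (@le_trans _ _ (\sum_(1 <= i < (m.+2 ^ 2).+1) (K / m.+2%:R ^+ 4))).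
  rewrite big_seq [leRHS]big_seq; apply: ler_sum => i.
  by rewrite mem_index_iota ltnS => /andP[_ im]; exact: HK.
rewrite sumr_const_nat subn1 -[leLHS]mulr_natl/= natrX.
have m2 : 0 < m.+2%:R :> R by [].
have -> : m.+2%:R ^+ 2 * (K / m.+2%:R ^+ 4) = K * (m.+2%:R ^+ 2)^-1 :> R.
  by field; rewrite gt_eqF.
apply: ler_wpM2l; first exact: ltW.
by rewrite lef_pV2 ?posrE ?exprn_gt0// lerXn2r ?nnegrE// ler_nat.
Qed.

Definition grid_good (al : R) := forall e : R, 0 < e ->
  exists (m0 : nat) (l0 : R), forall m i : nat, (m0 <= m)%N ->
    (1 <= i <= m ^ 2)%N -> l0 <= grid_len m i ->
  `|\int[leb_itv 0 1]_x
      heat v p ((hit_count a (grid_width m i) (m ^ 7) (al, x) - grid_len m i)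
        / Num.sqrt (grid_len m i)) - heat v (p + 1) 0| <= e.

(** All windows of the grid are controlled at once, since the sum over them of the
    errors tends to [0]. *)
Lemma grid_ae : {ae leb_itv (- A) A, forall al, grid_good al}.
Proof.
apply: filterS grid_total_ae => al Hal e e0.
pose B := isd p; have B0 : 0 < B by exact: isd_gt0.
have [n0 Hn0] : exists n0, forall n, (n0 <= n)%N ->
    grid_total n.+2 al <= Num.min (e / 4) ((e / 4) ^+ 2).
  have d0 : 0 < Num.min (e / 4) ((e / 4) ^+ 2).
    by rewrite lt_min exprn_gt0 ?divr_gt0.
  have /cvgrPdist_le/(_ _ d0)[n0 _ H] := Hal.
  exists n0 => n n0n; have := H n n0n; rewrite /= sub0r normrN.
  exact: le_trans (ler_norm _).
pose m1 := Num.truncn ((B ^+ 2 + 4 * B ^+ 4) * 4 / e).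
exists (maxn n0.+2 m1.+1), (Num.max 1 ((24 * B ^+ 3 / e) ^+ 2)).
move=> m i; rewrite geq_max => /andP[nm m1m] /andP[i1 im].
rewrite ge_max => /andP[l1 l2].
have m2 : (2 <= m)%N by lia.
have m0 : (0 < m)%N by lia.
have n0m : (n0 <= m - 2)%N by lia.
have m0R : 0 < m%:R :> R by rewrite ltr0n.
have m1R : 1 <= m%:R :> R by rewrite ler1n.
set l := grid_len m i in l1 l2 *.
have l0 : 0 < l by exact: lt_le_trans l1.
have lm : l <= m%:R.
  by rewrite /l /grid_len ler_pdivrMr// -natrM ler_nat mulnn.
have mN : m%:R <= (N m)%:R :> R by rewrite ler_nat -[leqLHS]expn1 leq_pexp2l.
have NmR : (N m)%:R = m%:R ^+ 7 :> R by rewrite natrX.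
have w2 := grid_width_le m2 im; have w0 := grid_width_ge0 m i.
have := @quenched_le R a C a1 C1 (grid_width m i) w0 w2 (test_fun (N m) l) (test_fun_bounds _ _)
  (measurable_test_fun _ _) m m0 (step_err (N m) l) (N m)
  (fun j s => @test_fun_step (N m) l j s l0 (le_trans lm mN)) al.
have N0 : 0 < (N m)%:R :> R by exact: lt_le_trans mN.
have -> : test_fun (N m) l 0 0 = heat v (p + 1) 0.
  by rewrite /test_fun mulr0n !mul0r !subr0 mul0r.
have EI x : test_fun (N m) l (N m) (hit_count a (grid_width m i) (N m) (al, x)) =
    heat v p ((hit_count a (grid_width m i) (N m) (al, x) - l) / Num.sqrt l).
  have E1 : (N m)%:R / (N m)%:R = 1 :> R by rewrite divff// gt_eqF.
  have E2 : (N m)%:R * (l / (N m)%:R) = l by rewrite mulrC divfK// gt_eqF.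
  by rewrite /test_fun E1 E2 subrr addr0.
move=> HQ.
under eq_Rintegral do rewrite -EI.
apply: (le_trans HQ).
have Qi : grid_err m i al <= Num.min (e / 4) ((e / 4) ^+ 2).
  have := Hn0 (m - 2)%N; rewrite -[(m - 2).+2]addn2 subnK// => H.
  apply: le_trans (H n0m).
  rewrite /grid_total (bigD1_seq i) ?iota_uniq//=; last by rewrite mem_index_iota i1 ltnS.
  by rewrite lerDl sumr_ge0// => j _; exact: grid_err_ge0.
move: Qi; rewrite le_min => /andP[Q1 Q2].
have R0 : 0 <= cross_sum a (grid_width m i) m (N m) al by exact: cross_sum_ge0.
have hM : `|main_sum a (grid_width m i) (test_fun (N m) l) m (N m) al| <= e / 4.
  have e4 : 0 <= e / 4 by rewrite divr_ge0// ltW.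
  rewrite -(ler_pXn2r (n := 2)) ?nnegrE// real_normK ?num_real//.
  apply: le_trans Q2; rewrite /grid_err -/l; set M2 := _ ^+ 2; lra.
have hR : cross_sum a (grid_width m i) m (N m) al <= e / 4.
  by apply: le_trans Q1; rewrite /grid_err lerDr sqr_ge0.
have hS : (N m)%:R * step_err (N m) l <= e / 2.
  rewrite /step_err mulVKf ?gt_eqF// -/B.
  have s1 : 6 * B ^+ 3 / Num.sqrt l <= e / 4.
    rewrite ler_pdivrMr ?sqrtr_gt0//.
    have : 24 * B ^+ 3 / e <= Num.sqrt l.
      rewrite -[leLHS]ger0_norm; last by rewrite divr_ge0 ?mulr_ge0 ?exprn_ge0// ltW.
      by rewrite -sqrtr_sqr ler_wsqrtr.
    by rewrite ler_pdivrMr//; lra.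
  have N1 : (N m)%:R^-1 <= m%:R^-1 :> R by rewrite lef_pV2.
  have s2 : l / (N m)%:R <= m%:R^-1.
    rewrite ler_pdivrMr// mulrC ler_pdivlMr// NmR.
    apply: (@le_trans _ _ (m%:R ^+ 2)); first by rewrite expr2 ler_wpM2r// ltW.
    exact: ler_weXn2l.
  have s3 : (B ^+ 2 + 4 * B ^+ 4) / m%:R <= e / 4.
    have : (B ^+ 2 + 4 * B ^+ 4) * 4 / e < m%:R.
      by apply: lt_le_trans (truncnS_gt _) _; rewrite ler_nat.
    by rewrite ltr_pdivrMr// ler_pdivrMr//; lra.
  have t2 : B ^+ 2 * (l / (N m)%:R) <= B ^+ 2 * m%:R^-1.
    by rewrite ler_wpM2l// sqr_ge0.
  have t3 : 4 * B ^+ 4 / (N m)%:R <= 4 * B ^+ 4 / m%:R.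
    by rewrite ler_wpM2l// mulr_ge0// exprn_ge0// ltW.
  by move: s1 s3 t2 t3; rewrite mulrDl; lra.
by move: hM hR hS; lra.
Qed.

End grid.

(** * From the grid to all numbers of points *)

Section transfer.
Context {R : realType}.
Variable a : nat -> R.

Let mX := @leb_itv R 0 1.

Lemma bint_hit_shift (w t c : R) : 0 <= w <= 1 ->
  \int[mX]_x hit w (t - x + c) <= 3 * w.
Proof.
move=> w01; apply: le_trans (int_hit_unit (t + c) w01).
by rewrite le_eqVlt; apply/orP; left; apply/eqP/eq_Rintegral => x _; rewrite addrAC.
Qed.

Lemma hit_dist (w w' t : R) : `|hit w t - hit w' t| <=
  hit (`|w - w'| / 2) (t + - ((w + w') / 4)) + hit (`|w - w'| / 2) (t + (w + w') / 4).
Proof.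
wlog ww : w w' / w' <= w => [W|].
  have [|/ltW] := leP w' w; first exact: W.
  by move/W; rewrite distrC (distrC w) (addrC w).
rewrite (ger0_norm (_ : 0 <= w - w')) ?subr_ge0// ger0_norm ?subr_ge0 ?hit_mono//.
by have := hit_widen w' w t; rewrite (addrC w'); lra.
Qed.

Lemma bmeas_hit_affine (w t c : R) : bmeas (fun x : R => hit w (t - x + c)).
Proof.
by apply: hit_bmeas; apply: measurable_funD => //; exact: measurable_funB.
Qed.

Lemma bint_hit_dist (w w' t : R) : 0 <= w <= 1 -> 0 <= w' <= 1 ->
  \int[mX]_x `|hit w (t - x) - hit w' (t - x)| <= 3 * `|w - w'|.
Proof.
move=> /andP[w0 w1] /andP[w0' w1'].
have d01 : 0 <= `|w - w'| / 2 <= 1.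
  rewrite divr_ge0//= ler_pdivrMr// mul1r ler_norml; apply/andP; split; lra.
set d := `|w - w'| / 2 in d01 *; set c := (w + w') / 4.
have bh u : bmeas (fun x : R => hit u (t - x)).
  by apply: hit_bmeas; exact: measurable_funB.
have bs z := bmeas_hit_affine d t z.
apply: (@le_trans _ _ (\int[mX]_x (hit d (t - x + - c) + hit d (t - x + c)))).
  apply: bint_le.
  - by apply: bmeas_norm; apply: bmeasB.
  - by apply: bmeasD.
  - by move=> x; exact: hit_dist.
rewrite bintD//.
have h1 := bint_hit_shift t (- c) d01; have h2 := bint_hit_shift t c d01.
by apply: le_trans (lerD h1 h2) _; rewrite /d; lra.
Qed.

Lemma bint_hit_count_dist (w w' al : R) (n N : nat) : 0 <= w <= 1 -> 0 <= w' <= 1 ->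
  (n <= N)%N ->
  \int[mX]_x `|hit_count a w N (al, x) - hit_count a w' n (al, x)| <=
    3 * ((N - n)%:R * w) + 3 * (n%:R * `|w - w'|).
Proof.
move=> w01 w01' nN.
have bh u j : bmeas (fun x : R => hit_at a u j (al, x)) by exact: bmeas_sec1 (hit_at_bmeas a u j).
have bd j : bmeas (fun x : R => `|hit_at a w j (al, x) - hit_at a w' j (al, x)|).
  by apply: bmeas_norm; exact: bmeasB.
apply: (@le_trans _ _ (\int[mX]_x (\sum_(n.+1 <= j < N.+1) hit_at a w j (al, x)
   + \sum_(1 <= j < n.+1) `|hit_at a w j (al, x) - hit_at a w' j (al, x)|))).
  apply: bint_le.
  - apply: bmeas_norm; apply: bmeasB.
      exact: bmeas_sec1 (hit_count_bmeas a w N).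
    exact: bmeas_sec1 (hit_count_bmeas a w' n).
  - by apply: bmeasD; exact: bmeas_sum.
  - move=> x; rewrite (hit_count_sub a w _ nN) addrAC [leRHS]addrC.
    rewrite (le_trans (ler_normD _ _))// lerD//.
      rewrite /hit_count -sumrB; exact: ler_norm_sum.
    by rewrite ger0_norm// sumr_ge0// => j _; exact: hit_at_ge0.
rewrite bintD; [|exact: bmeas_sum|exact: bmeas_sum].
rewrite !bint_sum//; apply: lerD.
  apply: (@le_trans _ _ (\sum_(n.+1 <= j < N.+1) (3 * w))).
    by apply: ler_sum => j _; exact: (int_hit_unit (al * a j) w01).
  by rewrite sumr_const_nat subSS -[leLHS]mulr_natl mulrCA.
apply: (@le_trans _ _ (\sum_(1 <= j < n.+1) (3 * `|w - w'|))).
  by apply: ler_sum => j _; exact: (bint_hit_dist (al * a j) w01 w01').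
by rewrite sumr_const_nat subn1 -[leLHS]mulr_natl mulrCA.
Qed.

Lemma bint_hit_count_le (w al : R) (N : nat) : 0 <= w <= 1 ->
  \int[mX]_x hit_count a w N (al, x) <= 3 * (N%:R * w).
Proof.
move=> w01; rewrite bint_sum; last by move=> j _ _; exact: bmeas_sec1 (hit_at_bmeas a w j).
apply: (@le_trans _ _ (\sum_(1 <= j < N.+1) (3 * w))).
  by apply: ler_sum => j _; exact: (int_hit_unit (al * a j) w01).
by rewrite sumr_const_nat subn1 -[leLHS]mulr_natl mulrCA.
Qed.

Lemma hit_count_ge0 (w : R) N z : 0 <= hit_count a w N z.
Proof. by apply: sumr_ge0 => j _; exact: hit_at_ge0. Qed.

(** The bound is linear in [|S - S'|] and [|S - L|], whose integrals are known. *)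
Lemma renorm_le (S S' L l : R) : 1 <= l -> l <= L ->
  `|(S - L) / Num.sqrt L - (S' - l) / Num.sqrt l| <=
    `|S - S'| + (L - l) + `|S - L| * ((L - l) / L).
Proof.
move=> l1 lL.
have l0 : 0 < l by exact: lt_le_trans l1.
have L0 : 0 < L by exact: lt_le_trans lL.
have Ll0 : 0 <= L - l by rewrite subr_ge0.
set r := Num.sqrt L; set s := Num.sqrt l.
have s1 : 1 <= s by rewrite -[leLHS]sqrtr1 ler_wsqrtr.
have rs : s <= r by rewrite ler_wsqrtr.
have r2 : r ^+ 2 = L by rewrite sqr_sqrtr// ltW.
have s2 : s ^+ 2 = l by rewrite sqr_sqrtr// ltW.
have s0 : 0 < s by exact: lt_le_trans s1.
have r0 : 0 < r by exact: lt_le_trans rs.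
have is1 : s^-1 <= 1 by rewrite invf_le1.
have is0 : 0 < s^-1 by rewrite invr_gt0.
have D0 : 0 <= s^-1 - r^-1 by rewrite subr_ge0 lef_pV2.
have D1 : s^-1 - r^-1 <= (L - l) / L.
  have -> : s^-1 - r^-1 = (L - l) / (r * (s * (r + s))).
    by rewrite -r2 -s2; field; rewrite !gt_eqF// addr_gt0.
  rewrite ler_wpM2l// lef_pV2 ?posrE// ?mulr_gt0 ?addr_gt0//.
  by rewrite -r2 expr2 ler_pM2l//; nra.
have -> : (S - L) / r - (S' - l) / s =
    (S - S') * s^-1 - (L - l) * s^-1 - (S - L) * (s^-1 - r^-1).
  by field; rewrite !gt_eqF.
rewrite (le_trans (ler_normB _ _))// lerD//.
  rewrite (le_trans (ler_normB _ _))// lerD//.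
    by rewrite normrM (gtr0_norm is0) ler_piMr.
  by rewrite normrM (gtr0_norm is0) (ger0_norm Ll0) ler_piMr.
by rewrite normrM (ger0_norm D0) ler_wpM2l.
Qed.

Lemma pow7_gap (m : nat) : (0 < m)%N ->
  m.+1%:R ^+ 7 - m%:R ^+ 7 <= 448 * m%:R ^+ 6 :> R.
Proof.
move=> m0; have m1 : 1 <= m%:R :> R by rewrite ler1n.
rewrite subrXX -[m.+1%:R]natr1; set x := m%:R in m1 *.
have -> : x + 1 - x = 1 by ring.
rewrite mul1r; apply: (@le_trans _ _ (\sum_(i < 7) ((2 * x) ^+ 6))); last first.
  by rewrite sumr_const card_ord exprMn -[leLHS]mulr_natl mulrA; apply/ler_wpM2r;
    [rewrite exprn_ge0//; lra|lra].
apply: ler_sum => i _.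
have i6 : (7.-1 - i + i = 6)%N by have := ltn_ord i; case: i => i /= h; lia.
apply: (@le_trans _ _ ((2 * x) ^+ (7.-1 - i) * (2 * x) ^+ i)); last first.
  by rewrite -exprD i6.
by apply: ler_pM; rewrite ?exprn_ge0 ?lerXn2r ?nnegrE//; lra.
Qed.

(** Rounding [L] down to a multiple of [1 / m] and the number of points down to
    [m ^ 7] changes few of the hits: the relative gap between consecutive
    seventh powers is of order [1 / m], and both changes are measured in
    [L^1(dx)], where the cost of a window is proportional to its width. *)
Lemma compare (v p al L : R) (m N : nat) : (0 < m)%N ->
  (m ^ 7 <= N)%N -> (N <= m.+1 ^ 7)%N -> 2 <= L -> L <= m%:R ->
  let i := Num.truncn (L * m%:R) in
  [/\ (1 <= i <= m ^ 2)%N, L - 1 <= grid_len m i &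
  `|\int[mX]_x heat v p ((hit_count a (L / N%:R) N (al, x) - L) / Num.sqrt L)
    - \int[mX]_x heat v p ((hit_count a (grid_width m i) (m ^ 7) (al, x) - grid_len m i)
      / Num.sqrt (grid_len m i))| <= isd p * (2696 * (L / m%:R))].
Proof.
move=> m0 mN NM L2 Lm i.
have m0R : 0 < m%:R :> R by rewrite ltr0n.
have m1R : 1 <= m%:R :> R by rewrite ler1n.
have L0 : 0 < L by apply: lt_le_trans L2.
have Lm0 : 0 <= L * m%:R by rewrite mulr_ge0 ?ltW.
have i_le : i%:R <= L * m%:R by rewrite truncn_le.
have i_gt : L * m%:R < i.+1%:R by exact: truncnS_gt.
have im2 : (i <= m ^ 2)%N.
  rewrite -(ler_nat R) (le_trans i_le)// natrX expr2 ler_pM2r//.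
set l := grid_len m i; set w' := grid_width m i; set w := L / N%:R.
have lL : l <= L by rewrite /l /grid_len ler_pdivrMr.
have Ll : L - l <= m%:R^-1.
  have -> : L - l = (L * m%:R - i%:R) / m%:R.
    by rewrite /l /grid_len; field; rewrite gt_eqF.
  rewrite ler_pdivrMr// mulVf ?gt_eqF//.
  by move: i_gt; rewrite -natr1; lra.
have im1 : m%:R^-1 <= 1 :> R by rewrite invf_le1.
have l1 : 1 <= l by move: Ll im1 L2; lra.
have i1 : (1 <= i)%N.
  by rewrite lt0n; apply/eqP => i0; move: l1; rewrite /l /grid_len i0 mul0r; lra.
split; [by rewrite i1|by move: Ll im1; lra|].
pose n := (m ^ 7)%N.
have nR : n%:R = m%:R ^+ 7 :> R by rewrite natrX.
have n0 : 0 < n%:R :> R by rewrite nR exprn_gt0.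
have nN : n%:R <= N%:R :> R by rewrite ler_nat.
have N0 : 0 < N%:R :> R by exact: lt_le_trans nN.
have mn : m%:R <= n%:R :> R by rewrite ler_nat -[leqLHS]expn1 leq_pexp2l.
have w01 : 0 <= w <= 1.
  rewrite /w divr_ge0 ?(ltW L0)//= ler_pdivrMr// mul1r.
  by rewrite (le_trans Lm)// (le_trans mn).
have w01' : 0 <= w' <= 1.
  rewrite /w' /grid_width -/l -/n divr_ge0 ?(le_trans ler01 l1)//= ler_pdivrMr// mul1r.
  by rewrite (le_trans lL)// (le_trans Lm).
pose S x := hit_count a w N (al, x); pose S' x := hit_count a w' n (al, x).
have bS : bmeas S by exact: bmeas_sec1 (hit_count_bmeas a w N).
have bS' : bmeas S' by exact: bmeas_sec1 (hit_count_bmeas a w' n).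
have bH (T : R -> R) L' : bmeas T -> bmeas (fun x => heat v p ((T x - L') / Num.sqrt L')).
  move=> [mT _]; split.
    apply: (measurableT_comp (measurable_heat v p)).
    by apply: measurable_funM => //; exact: measurable_funB.
  by exists 1 => x; rewrite ger0_norm ?heat_ge0// heat_le1.
rewrite -/n -bintB; [|exact: (bH S)|exact: (bH S')].
apply: le_trans (bint_abs _ (bmeasB (bH S L bS) (bH S' l bS'))) _.
have bSS : bmeas (fun x => `|S x - S' x|) by apply: bmeas_norm; exact: bmeasB.
have bSL : bmeas (fun x => S x + L) by apply: bmeasD => //; exact: bmeas_cst.
have bSLc : bmeas (fun x => (S x + L) * ((L - l) / L)).
  by apply: bmeasM => //; exact: bmeas_cst.
have bSSL : bmeas (fun x => `|S x - S' x| + (L - l)).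
  by apply: bmeasD => //; exact: bmeas_cst.
have bsum : bmeas (fun x => `|S x - S' x| + (L - l) + (S x + L) * ((L - l) / L)).
  exact: bmeasD.
apply: (@le_trans _ _ (\int[mX]_x (isd p *
    (`|S x - S' x| + (L - l) + (S x + L) * ((L - l) / L))))).
  apply: bint_le.
  - by apply: bmeas_norm; apply: bmeasB; [exact: (bH S)|exact: (bH S')].
  - by apply: bmeasM => //; exact: bmeas_cst.
  - move=> x; apply: le_trans (heat_lip _ _ _ _) _; rewrite ler_wpM2l ?isd_ge0//.
    apply: le_trans (renorm_le _ _ l1 lL) _; rewrite lerD2l ler_wpM2r//.
      by rewrite divr_ge0 ?subr_ge0// ltW.
    by apply: le_trans (ler_normB _ _) _; rewrite (gtr0_norm L0) ger0_norm// hit_count_ge0.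
rewrite bintZ//; apply: ler_wpM2l; first exact: isd_ge0.
rewrite (bintD _ bSSL bSLc) (bintD _ bSS (bmeas_cst (L - l))).
rewrite (bintZr _ _ bSL) (bintD _ bS (bmeas_cst L)).
rewrite !bint_cst leb_itvT// subr0 !mulr1.
have H1 := bint_hit_count_dist al w01 w01' mN; rewrite -/(S _) -/(S' _) in H1.
have H2 := bint_hit_count_le al N w01.
have NwL : N%:R * w = L by rewrite /w mulrC divfK// gt_eqF.
rewrite NwL in H2.
have nw : n%:R * `|w - w'| <= L / N%:R * (N%:R - n%:R) + (L - l).
  rewrite -[n%:R]ger0_norm ?ler0n// -normrM.
  have -> : n%:R * (w - w') = - (L / N%:R * (N%:R - n%:R)) + (L - l).
    by rewrite /w /w' /grid_width -/l -/n; field; rewrite !gt_eqF.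
  rewrite (le_trans (ler_normD _ _))// normrN !ger0_norm ?subr_ge0//.
  by rewrite mulr_ge0 ?subr_ge0// divr_ge0// ltW.
have gap : L / N%:R * (N%:R - n%:R) <= 448 * (L / m%:R).
  have g1 : N%:R - n%:R <= 448 * m%:R ^+ 6 :> R.
    apply: le_trans (pow7_gap m0); rewrite nR lerD2r -natrX ler_nat //.
  rewrite mulrAC ler_pdivrMr//.
  apply: (@le_trans _ _ (L * (448 * m%:R ^+ 6))); first by rewrite ler_pM2l.
  have -> : L * (448 * m%:R ^+ 6) = 448 * (L / m%:R) * m%:R ^+ 7.
    by field; rewrite gt_eqF.
  by rewrite ler_wpM2l ?mulr_ge0 ?divr_ge0 ?(ltW L0)// -nR.
have cc : (\int[mX]_x S x + L) * ((L - l) / L) <= 4 * m%:R^-1.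
  apply: (@le_trans _ _ (4 * L * ((L - l) / L))).
    rewrite ler_wpM2r ?divr_ge0 ?subr_ge0 ?(ltW L0)//.
    by move: H2; rewrite /S; lra.
  have -> : 4 * L * ((L - l) / L) = 4 * (L - l) by field; rewrite gt_eqF.
  by rewrite ler_wpM2l.
have imL : m%:R^-1 <= (L / m%:R) / 2.
  rewrite ler_pdivlMr// mulrC ler_pdivlMr// mulfVK ?gt_eqF//.
rewrite natrB // -/n (_ : (N%:R - n%:R) * w = L / N%:R * (N%:R - n%:R)) in H1; last first.
  by rewrite /w mulrC.
move: H1 nw gap cc imL Ll; rewrite -/(S _).
set I1 := \int[mX]_x `|S x - S' x|; set I2 := \int[mX]_x S x.
set g := L / N%:R * _; set t := L / m%:R; set y := m%:R^-1; set k := _ * `|w - w'|.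
set c := (I2 + L) * _.
clearbody I1 g t y k c.
lra.
Qed.

Lemma root7 (N : nat) : exists m, (m ^ 7 <= N < m.+1 ^ 7)%N.
Proof.
elim: N => [|N [m /andP[h1 h2]]]; first by exists 0%N.
have [h|h] := leqP (m.+1 ^ 7) N.+1.
  exists m.+1; rewrite h /= (leq_ltn_trans h2)// ltn_exp2r//.
by exists m; rewrite h andbT (leq_trans h1).
Qed.

End transfer.

(** * From smoothed indicators to intervals *)

Section ae_tools.
Context {R : realType}.

Lemma ae_count d (T : measurableType d) (mu : {measure set T -> \bar R})
    (I : countType) (P : I -> T -> Prop) :
  (forall i, {ae mu, forall x, P i x}) -> {ae mu, forall x, forall i, P i x}.
Proof.
move=> H.
have : {ae mu, forall x, forall n, if unpickle n is Some i then P i x else True}.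
  apply: ae_foralln => n; case: (unpickle n) => [i|]; first exact: H.
  exact: aeW.
apply: filterS => x Hx i; have := Hx (pickle i); by rewrite pickleK.
Qed.

Lemma ae_lebesgue (P : R -> Prop) :
  (forall k : nat, {ae leb_itv (- k.+1%:R) k.+1%:R, forall al, P al}) ->
  {ae @lebesgue_measure R, forall al, P al}.
Proof.
move=> H.
have : (@lebesgue_measure R).-negligible
    (\bigcup_k (~` P `&` `[(- k.+1%:R)%R, k.+1%:R[%classic)).
  apply: negligible_bigcup => k; have [B [mB B0 PB]] := H k.
  exists (B `&` `[- k.+1%:R, k.+1%:R[%classic); split => //.
    exact: measurableI.
  by move=> x [Px xk]; split => //; exact: PB.
apply: negligibleS => x Px.
exists (Num.truncn `|x|) => //; split => //=; rewrite in_itv/=.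
have := truncnS_gt `|x|; rewrite ltr_norml => /andP[h1 h2].
by rewrite (ltW h1) h2.
Qed.

End ae_tools.

Section one_test.
Context {R : realType}.
Variables (a L : nat -> R).

Hypothesis Ly : forall M : R, exists N0, forall N, (N0 <= N)%N -> M <= L N.
Hypothesis L14 : exists K : R, exists N0, forall N, (N0 <= N)%N ->
  L N ^+ 14 <= K * N%:R.

(* for [N] of the order of [m ^ 7], [L = O(N ^ (1/14))] reads [L = O(sqrt m)],
   which beats the loss [L / m] of [compare] *)
Let L_sqr : exists2 K : R, 1 <= K & exists N0, forall N m : nat, (N0 <= N)%N ->
  (0 < m)%N -> (N < m.+1 ^ 7)%N -> L N ^+ 2 <= K * m%:R.
Proof.
have [K [N0 H]] := L14; pose K1 := Num.max 1 K.
have K1_1 : 1 <= K1 by rewrite le_max lexx.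
exists (2 * K1); first by move: K1_1; lra.
exists N0 => N m NN0 m0 Nm.
have m1 : 1 <= m%:R :> R by rewrite ler1n.
rewrite -(ler_pXn2r (n := 7)) ?nnegrE ?sqr_ge0//; last first.
  by rewrite mulr_ge0 ?mulr_ge0// (le_trans ler01).
rewrite -exprM; apply: le_trans (H N NN0) _.
apply: (@le_trans _ _ (K1 * (2 * m%:R) ^+ 7)).
  apply: (@le_trans _ _ (K1 * N%:R)).
    by rewrite ler_wpM2r// le_max lexx orbT.
  rewrite ler_wpM2l ?(le_trans ler01)//.
  apply: (@le_trans _ _ (m.+1%:R ^+ 7)); first by rewrite -natrX ler_nat ltnW.
  by rewrite lerXn2r ?nnegrE ?mulr_ge0// -natr1; lra.
rewrite [2 * K1]mulrC -mulrA [leRHS]exprMn ler_wpM2r ?exprn_ge0 ?mulr_ge0//.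
by rewrite exprS ler_peMr ?(le_trans ler01)// exprn_ege1.
Qed.

Lemma test_cvg (v p al : R) : grid_good a v p al -> forall e : R, 0 < e ->
  exists N0, forall N, (N0 <= N)%N ->
  `|\int[leb_itv 0 1]_x heat v p ((hit_count a (L N / N%:R) N (al, x) - L N)
      / Num.sqrt (L N)) - heat v (p + 1) 0| <= e.
Proof.
move=> good e e0.
have [K K1 [N1 HN1]] := L_sqr.
have K0 : 0 < K by exact: lt_le_trans K1.
have e2 : 0 < e / 2 by rewrite divr_gt0.
have [m0 [l0 Hgrid]] := good (e / 2) e2.
have [N2 HN2] := Ly (Num.max 2 (l0 + 1)).
pose B := 2696 * isd p.
have B0 : 0 < B by apply: mulr_gt0; [rewrite ltr0n|exact: isd_gt0].
pose T := Num.max K (K * (B / (e / 2)) ^+ 2).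
pose m1 := maxn (maxn m0 1) (Num.truncn T).+1.
exists (maxn (m1 ^ 7) (maxn N1 N2)) => N.
rewrite !geq_max => /andP[Nm1 /andP[NN1 NN2]].
have [m /andP[mN Nm]] := root7 N.
have m1m : (m1 <= m)%N.
  rewrite -ltnS -(@ltn_exp2r _ _ 7)//; exact: leq_ltn_trans Nm1 Nm.
move: m1m; rewrite !geq_max => /andP[/andP[m0m m_gt0] Tm].
have mR : 0 < m%:R :> R by rewrite ltr0n.
have {}Tm : T <= m%:R.
  by apply: ltW; apply: lt_le_trans (truncnS_gt _) _; rewrite ler_nat.
move: Tm; rewrite ge_max => /andP[Km Tm].
move: (HN2 N NN2); rewrite ge_max => /andP[L2 Ll0].
have LK := HN1 N m NN1 m_gt0 Nm.
have L0 : 0 < L N by exact: lt_le_trans L2.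
have Lm : L N <= m%:R.
  rewrite -(ler_pXn2r (n := 2)) ?nnegrE ?(ltW L0)//.
  by apply: le_trans LK _; rewrite expr2 ler_pM2r.
have [ii gi H] := compare a v p al m_gt0 mN (ltnW Nm) L2 Lm.
set i := Num.truncn _ in ii gi H.
have gg : l0 <= grid_len m i by move: gi Ll0; lra.
have HG := Hgrid m i m0m ii gg.
have BL : isd p * (2696 * (L N / m%:R)) <= e / 2.
  have -> : isd p * (2696 * (L N / m%:R)) = B * (L N / m%:R) by rewrite /B; ring.
  rewrite mulrC -ler_pdivlMr//.
  have n1 : 0 <= L N / m%:R by rewrite divr_ge0// ltW.
  have n2 : 0 <= e / 2 / B by exact: divr_ge0 (ltW e2) (ltW B0).
  rewrite -(@ler_pXn2r _ 2%N)// expr_div_n ler_pdivrMr ?exprn_gt0//; apply: le_trans LK _.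
  have -> : m%:R ^+ 2 = m%:R * m%:R :> R by rewrite expr2.
  rewrite mulrA ler_pM2r//.
  have -> : (e / 2 / B) ^+ 2 * m%:R = m%:R / (B / (e / 2)) ^+ 2.
    by field; rewrite !gt_eqF.
  by rewrite ler_pdivlMr// exprn_gt0//; exact: divr_gt0.
rewrite [leRHS]splitr.
exact: (le_trans (ler_distD _ _ _) (lerD (le_trans H BL) HG)).
Qed.

End one_test.

Section sandwich.
Context {R : realType}.

Lemma isd_ge (p : R) : 0 < p -> 1 - p <= isd (1 + p).
Proof.
move=> p0; apply: le_trans (expR_ge1Dx _); rewrite lerD2l lerN2.
rewrite ler_pdivrMr//; apply: le_trans (le_ln1Dx _) _; lra.
Qed.

(** The limit for the smoothed indicator is a normal probability of variance
    [p + 1] in place of [1]. *)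
Lemma heat_limit_close (v v' p d : R) : 0 < p -> 0 <= d -> `|v' - v| <= d ->
  `|heat v' (p + 1) 0 - gcdf v| <= d + (`|v| + d) * p.
Proof.
move=> p0 d0 vd; rewrite /heat subr0; apply: le_trans (gcdf_lip _ _) _.
have -> : v' * isd (p + 1) - v = (v' - v) - v' * (1 - isd (p + 1)) by ring.
rewrite (le_trans (ler_normB _ _))// lerD// normrM.
have i1 : isd (p + 1) <= 1 by rewrite -[leRHS]isd1; apply: isd_le => //; lra.
rewrite [X in _ * X]ger0_norm ?subr_ge0//; apply: ler_pM; rewrite ?subr_ge0//.
  have -> : v' = v + (v' - v) by ring.
  by rewrite (le_trans (ler_normD _ _))// lerD2l.
by have := isd_ge p0; rewrite (addrC 1 p); lra.
Qed.

Definition test_var (k : nat) : R := k.+1%:R^-1.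

Lemma test_var_gt0 k : 0 < test_var k. Proof. by rewrite invr_gt0. Qed.

(** A small variance makes the smoothed indicator drop from [1] to [0] within a
    distance [d], and moves its limit little. *)
Lemma test_var_small (d z e V : R) : 0 < d -> 0 < z -> 0 < e -> 0 <= V ->
  exists k, z <= d * isd (test_var k) /\ V * test_var k <= e.
Proof.
move=> d0 z0 e0 V0.
pose T := Num.max ((z / d) ^+ 2) (V / e).
exists (Num.truncn T); set k := Num.truncn T.
have : T <= k.+1%:R by exact/ltW/truncnS_gt.
rewrite ge_max => /andP[h1 h2]; split.
  rewrite mulrC -ler_pdivrMr// -(ler_pXn2r (n := 2)) ?nnegrE ?isd_ge0//; last first.
    by rewrite divr_ge0// ltW.
  by rewrite isd_sqr ?test_var_gt0// /test_var invrK.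
by rewrite /test_var ler_pdivrMr// mulrC -ler_pdivrMr.
Qed.

(** The rational threshold lies slightly above [v], at a distance that is large
    compared with the standard deviation of the smoothing. *)
Lemma approx_above (v e : R) : 0 < e -> exists (q : rat) (k : nat),
  (forall y, y <= v -> 1 - e <= heat (ratr q) (test_var k) y) /\
  `|heat (ratr q) (test_var k + 1) 0 - gcdf v| <= e.
Proof.
move=> e0; have [z z0 [_ z1]] := @gcdf_tails R e e0.
have d0 : 0 < e / 4 by rewrite divr_gt0.
have e2 : 0 < e / 2 by rewrite divr_gt0.
have ve : 0 <= `|v| + e / 2 by rewrite addr_ge0// ltW.
have [|q] := @rat_in_itvoo R (v + e / 4) (v + e / 2); first by lra.
rewrite in_itv/= => /andP[q1 q2]; have vq : `|ratr q - v| <= e / 2.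
  by rewrite ler_norml; apply/andP; split; lra.
have [k [k1 k2]] := test_var_small d0 z0 e2 ve.
exists q, k; split => [y yv|].
  apply: (le_trans z1); apply: gcdf_mono; apply: (le_trans k1).
  by rewrite ler_wpM2r ?isd_ge0//; lra.
apply: le_trans (heat_limit_close (test_var_gt0 k) (ltW e2) vq) _.
by rewrite [leRHS]splitr lerD2l.
Qed.

Lemma approx_below (v e : R) : 0 < e -> exists (q : rat) (k : nat),
  (forall y, v <= y -> heat (ratr q) (test_var k) y <= e) /\
  `|heat (ratr q) (test_var k + 1) 0 - gcdf v| <= e.
Proof.
move=> e0; have [z z0 [z1 _]] := @gcdf_tails R e e0.
have d0 : 0 < e / 4 by rewrite divr_gt0.
have e2 : 0 < e / 2 by rewrite divr_gt0.
have ve : 0 <= `|v| + e / 2 by rewrite addr_ge0// ltW.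
have [|q] := @rat_in_itvoo R (v - e / 2) (v - e / 4); first by lra.
rewrite in_itv/= => /andP[q1 q2]; have vq : `|ratr q - v| <= e / 2.
  by rewrite ler_norml; apply/andP; split; lra.
have [k [k1 k2]] := test_var_small d0 z0 e2 ve.
exists q, k; split => [y yv|].
  apply: le_trans z1; apply: gcdf_mono; rewrite lerNr; apply: (le_trans k1).
  by rewrite -mulNr ler_wpM2r ?isd_ge0//; lra.
apply: le_trans (heat_limit_close (test_var_gt0 k) (ltW e2) vq) _.
by rewrite [leRHS]splitr lerD2l.
Qed.

Lemma bmeas_heat (v p : R) (W : R -> R) : measurable_fun setT W ->
  bmeas (fun x => heat v p (W x)).
Proof.
move=> mW; split.
  by apply: (measurableT_comp (measurable_heat v p)).
by exists 1 => x; rewrite ger0_norm ?heat_ge0// heat_le1.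
Qed.

Lemma measurable_between (W : R -> R) (u v : R) : measurable_fun setT W ->
  measurable [set x | u <= W x <= v].
Proof.
move=> mW; rewrite (_ : [set x | _] = W @^-1` `[u, v]%classic).
  by rewrite -[X in measurable X]setTI; apply: mW.
by apply/seteqP; split => x /=; rewrite in_itv.
Qed.

Lemma indicator_le (u v d y h h' : R) : u < v -> 0 < d -> 0 <= h -> h' <= 1 ->
  (y <= v -> 1 - d <= h) -> (u <= y -> h' <= d) ->
  ((u <= y <= v)%R : bool)%:R <= h - h' + 2 * d.
Proof.
move=> uv d0 h0 h1 hv hu; have [uy|yu] := leP u y; have [yv|vy] := leP y v => /=.
- by have := hv yv; have := hu uy; lra.
- by have := hu uy; lra.
- by have := hv yv; lra.
- lra.
Qed.

Lemma indicator_ge (u v d y h h' : R) : u < v -> 0 < d -> 0 <= h -> h' <= 1 ->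
  (y <= u -> 1 - d <= h) -> (v <= y -> h' <= d) ->
  h' - h <= ((u <= y <= v)%R : bool)%:R + 2 * d.
Proof.
move=> uv d0 h0 h1 hu hv; have [uy|yu] := leP u y; have [yv|vy] := leP y v => /=.
- lra.
- by have := hv (ltW vy); lra.
- by have := hu (ltW yu); lra.
- lra.
Qed.

(** The indicator of [u <= y <= v] is squeezed between two differences of smoothed
    indicators, with thresholds on either side of [u] and of [v]. Countably many
    test functions suffice, which allows one exceptional null set of [alpha] for
    all [u] and [v]. *)
Lemma cvg_distribution (W : nat -> R -> R) :
  (forall N, measurable_fun setT (W N)) ->
  (forall (q : rat) k e, 0 < e -> exists N0, forall N, (N0 <= N)%N ->
    `|\int[leb_itv 0 1]_x heat (ratr q) (test_var k) (W N x)
      - heat (ratr q) (test_var k + 1) 0| <= e) ->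
  forall u v e : R, u < v -> 0 < e -> exists N0, forall N, (N0 <= N)%N ->
    `|\int[leb_itv 0 1]_x \1_[set x | u <= W N x <= v] x - (gcdf v - gcdf u)| <= e.
Proof.
move=> mW H u v e uv e0; pose d := e / 6.
have d0 : 0 < d by rewrite divr_gt0.
have [q1 [k1 [A1 B1]]] := approx_above v d0.
have [q2 [k2 [A2 B2]]] := approx_above u d0.
have [q3 [k3 [A3 B3]]] := approx_below v d0.
have [q4 [k4 [A4 B4]]] := approx_below u d0.
have [N1 H1] := H q1 k1 d d0; have [N2 H2] := H q2 k2 d d0.
have [N3 H3] := H q3 k3 d d0; have [N4 H4] := H q4 k4 d d0.
exists (maxn (maxn N1 N2) (maxn N3 N4)) => N.
rewrite !geq_max => /andP[/andP[/H1 {}H1 /H2 {}H2] /andP[/H3 {}H3 /H4 {}H4]].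
have bh q k : bmeas (fun x => heat (ratr q) (test_var k) (W N x)).
  exact: bmeas_heat.
pose E := [set x | u <= W N x <= v].
have bE : bmeas (\1_E : R -> R).
  split; first by apply: measurable_indic; exact: measurable_between.
  by exists 1 => x; rewrite indicE; case: (_ \in _) => /=; rewrite ?normr1// normr0.
have EP x : x \in E = (u <= W N x <= v) by apply/idP/idP; rewrite inE.
have up : \int[leb_itv 0 1]_x \1_E x <=
    \int[leb_itv 0 1]_x heat (ratr q1) (test_var k1) (W N x)
    - \int[leb_itv 0 1]_x heat (ratr q4) (test_var k4) (W N x) + 2 * d.
  rewrite -bintB// -[2 * d]mulr1 -[X in _ <= _ + _ * X](subr0 1).
  rewrite -(leb_itvT (@ler01 R)) -bint_cst -bintD; [|exact: bmeasB|exact: bmeas_cst].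
  apply: bint_le => //; first by apply: bmeasD; [exact: bmeasB|exact: bmeas_cst].
  move=> x; rewrite indicE EP; apply: indicator_le;
    [by []|by []|exact: heat_ge0|exact: heat_le1| |].
    exact: A1.
  exact: A4.
have lo : \int[leb_itv 0 1]_x heat (ratr q3) (test_var k3) (W N x)
    - \int[leb_itv 0 1]_x heat (ratr q2) (test_var k2) (W N x) <=
    \int[leb_itv 0 1]_x \1_E x + 2 * d.
  rewrite -bintB// -[2 * d]mulr1 -[X in _ <= _ + _ * X](subr0 1).
  rewrite -(leb_itvT (@ler01 R)) -bint_cst -bintD; [|exact: bE|exact: bmeas_cst].
  apply: bint_le; [exact: bmeasB|by apply: bmeasD => //; exact: bmeas_cst|].
  move=> x; rewrite indicE EP; apply: indicator_ge;
    [by []|by []|exact: heat_ge0|exact: heat_le1| |].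
    exact: A2.
  exact: A3.
have e6 : e = 6 * d by rewrite /d; field.
move: up lo H1 H2 H3 H4 B1 B2 B3 B4; rewrite e6 -/E.
generalize (gcdf u) (gcdf v) (\int[leb_itv 0 1]_x \1_E x)
  (\int[leb_itv 0 1]_x heat (ratr q1) (test_var k1) (W N x))
  (\int[leb_itv 0 1]_x heat (ratr q2) (test_var k2) (W N x))
  (\int[leb_itv 0 1]_x heat (ratr q3) (test_var k3) (W N x))
  (\int[leb_itv 0 1]_x heat (ratr q4) (test_var k4) (W N x))
  (heat (ratr q1) (test_var k1 + 1) 0) (heat (ratr q2) (test_var k2 + 1) 0)
  (heat (ratr q3) (test_var k3 + 1) 0) (heat (ratr q4) (test_var k4 + 1) 0).
clear => gu gv I I1 I2 I3 I4 h1 h2 h3 h4 up lo; rewrite !ler_norml.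
move=> /andP[? ?] /andP[? ?] /andP[? ?] /andP[? ?] /andP[? ?] /andP[? ?]
  /andP[? ?] /andP[? ?].
by apply/andP; split; lra.
Qed.

End sandwich.

Section statement.
Context {R : realType}.

(** Integers are at distance at least [1 > w] from each other, so at most one term
    is nonzero. *)
Lemma chi_sumE (w t : R) : 0 < w < 1 ->
  \sum_(n \in [set: int]) chi ((t + n%:~R) / w) = hit w t.
Proof.
move=> /andP[w0 w1].
have chiE (n : int) : chi ((t + n%:~R) / w) = ((`|t + n%:~R| <= w / 2)%R : bool)%:R.
  rewrite /chi indicE; congr (_%:R); congr nat_of_bool.
  have -> : (`|t + n%:~R| <= w / 2) = ((t + n%:~R) / w \in `[- (1 / 2), 1 / 2]).
    rewrite in_itv/= ler_norml (ler_pdivlMr _ _ w0) (ler_pdivrMr _ _ w0).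
    by rewrite mulNr div1r (mulrC 2^-1 w).
  by apply/idP/idP; rewrite inE.
rewrite /hit indicE; case: (boolP (t \in near_int w)) => [|h]; last first.
  rewrite fsbig1// => n _; rewrite chiE; case: leP => // hn.
  by move: h => /negP[]; rewrite inE; exists n.
rewrite inE => -[n hn].
rewrite -(@fsbig_widen _ _ _ _ [set n])//; last first.
  move=> k [_ /= /eqP kn]; rewrite chiE; case: leP => // hk; exfalso.
  have : `|(k - n)%:~R| < 1 :> R.
    have -> : (k - n)%:~R = (t + k%:~R) - (t + n%:~R) :> R by rewrite intrB; ring.
    by apply: le_lt_trans (ler_normB _ _) _; lra.
  by rewrite -intr_norm ltrz1 -[1]add0r ltzD1 normr_le0 subr_eq0 (negbTE kn).
by rewrite fsbig_set1 chiE hn.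
Qed.

Lemma S_hit_count (a : nat -> R) (N : nat) (l al x : R) : 0 < l / N%:R < 1 ->
  S_ a N l al x = hit_count a (l / N%:R) N (al, x).
Proof. by move=> w01; apply: eq_bigr => j _; rewrite chi_sumE. Qed.

Lemma gcdf_diff (u v : R) : u < v ->
  ((Num.sqrt (2 * pi))^-1%:E *
    \int[lebesgue_measure]_(t in `[u, v]) (expR (- (t ^+ 2) / 2))%:E)%E
  = (gcdf v - gcdf u)%:E.
Proof.
move=> uv; rewrite gcdf_sub ?ltW// /Rintegral fineK; last first.
  by apply: integrable_fin_num => //; exact: gdens_integrable.
rewrite -ge0_integralZl//.
apply/measurable_EFinP; apply: measurable_funTS; apply: measurableT_comp => //.
by apply: measurable_funM => //; apply: measurableT_comp => //; exact: measurable_funX.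
Qed.

End statement.

Theorem theorem1p3 (R : realType) (a : nat -> R) (L : nat -> R)
  (ha : positive_lacunary a)
  (hLpos : forall N : nat, (1 <= N)%N -> 0 < L N)
  (hLoo : L N @[N --> \oo] --> +oo)
  (hLO : forall eta : R, 0 < eta ->
    (L : nat -> R^o) =O_\oo (fun N : nat => N%:R `^ eta : R^o))
  (hLdiff : exists2 epsilon : R, 0 < epsilon &
    (fun N : nat => L N.+1 - L N : R^o)
      =O_\oo (fun N : nat => N%:R `^ (- epsilon) : R^o)) :
  \forall alpha \ae (@lebesgue_measure R), forall u v : R, u < v ->
    lebesgue_measure
      [set x : R | 0 <= x < 1 /\
        u <= (S_ a N (L N) alpha x - L N) / Num.sqrt (L N) <= v]
    @[N --> \oo] -->
    ((Num.sqrt (2 * pi))^-1%:E *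
      \int[lebesgue_measure]_(t in `[u, v]) (expR (- (t ^+ 2) / 2))%:E)%E.
Proof.
have [a1 [C C1 lac]] := ha.
have good : {ae @lebesgue_measure R, forall al, forall qk : rat * nat,
    grid_good a (ratr qk.1) (test_var qk.2) al}.
  apply: ae_count => -[q k]; apply: ae_lebesgue => n.
  by apply: (grid_ae a1 C1 lac) => //; exact: test_var_gt0.
have Ly (M : R) : exists N0, forall N, (N0 <= N)%N -> M <= L N.
  by have /cvgryPge/(_ M)[N0 _ HN0] := hLoo; exists N0.
have L14 : exists K : R, exists N0, forall N, (N0 <= N)%N -> L N ^+ 14 <= K * N%:R.
  have eta0 : 0 < 14^-1 :> R by rewrite invr_gt0.
  have /eqO_exP[K K0 [N0 _ HN0]] := hLO _ eta0.
  exists (K ^+ 14), N0 => N /HN0 /= H.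
  have N1 : N%:R `^ 14^-1 ^+ 14 = N%:R :> R.
    by rewrite -powR_mulrn ?powR_ge0// -powRrM mulVf// powRr1.
  apply: le_trans (ler_norm _) _; rewrite normrX -N1 -exprMn.
  rewrite lerXn2r ?nnegrE ?mulr_ge0 ?powR_ge0 ?(ltW K0)//.
  by move: H; rewrite (ger0_norm (powR_ge0 _ _)).
have small : exists N0, forall N, (N0 <= N)%N -> 0 < L N / N%:R < 1.
  have [K [N0 H]] := L14; have [N1 H1] := Ly (Num.max 1 (K + 1)).
  exists (maxn (maxn N0 N1) 1) => N.
  rewrite !geq_max => /andP[/andP[/H {}H /H1]].
  rewrite ge_max => /andP[L1 LK] N1'.
  have N0' : 0 < N%:R :> R by rewrite ltr0n.
  have L0 : 0 < L N by exact: lt_le_trans L1.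
  rewrite divr_gt0//= ltr_pdivrMr// mul1r ltNge; apply/negP => NL.
  have L2 : L N ^+ 2 <= L N ^+ 14 by exact: ler_weXn2l.
  move: L2 H; rewrite expr2; nra.
move: good; apply: filterS.
  exact: (ae_filter_ringOfSetsType (@lebesgue_measure R)).
move=> al good u v uv.
pose W N x := (hit_count a (L N / N%:R) N (al, x) - L N) / Num.sqrt (L N).
have mW N : measurable_fun setT (W N).
  apply: measurable_funM => //; apply: measurable_funB => //.
  by have [] := bmeas_sec1 al (hit_count_bmeas a (L N / N%:R) N).
have cvg (q : rat) k e : 0 < e -> exists N0, forall N, (N0 <= N)%N ->
    `|\int[leb_itv 0 1]_x heat (ratr q) (test_var k) (W N x)
      - heat (ratr q) (test_var k + 1) 0| <= e.
  exact: (test_cvg Ly L14 (good (q, k))).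
rewrite gcdf_diff//.
have [N0 HN0] := small.
apply: (@cvg_trans _ ((\int[leb_itv 0 1]_x \1_[set x | u <= W N x <= v] x)%:E
    @[N --> \oo])).
  apply: near_eq_cvg; exists N0 => // N NN0 /=.
  have mE := measurable_between u v (mW N).
  rewrite bint_leb_itv_indic// fineK; last first.
    rewrite ge0_fin_numE//; apply: (@le_lt_trans _ _ (leb_itv 0 1 setT)).
      by rewrite /= /leb_co /mrestr setTI; apply: le_measure; rewrite ?inE//;
        exact: measurableI.
    by rewrite ltey_eq fin_num_measure.
  congr lebesgue_measure; apply/seteqP; split => x /=.
    by rewrite in_itv/= => -[h1 h2]; rewrite S_hit_count ?HN0.
  by rewrite in_itv/= => -[h1]; rewrite S_hit_count ?HN0.
apply: cvg_EFin; first exact: nearW.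
apply/cvgrPdist_le => e e0.
have [N1 HN1] := cvg_distribution mW cvg uv e0.
by exists N1 => // N NN1 /=; rewrite distrC; exact: HN1.
Qed.
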